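(* For $a_n\in(0,1)$ and probability measures $\pi^m_n$ on $(0,\infty)$, $m,n\in\mathbb{N}$, let $$\rho_n:=(1-a_n)\Big(\delta_0+\sum_{k=1}^\infty (a_n)^k(\pi^1_n*\dots*\pi^k_n)\Big),\qquad m_n(\tau):=\lceil\tau(1-a_n)^{-1}\rceil .$$ (i) Suppose $a_n\nearrow1$ and there is an infinitely divisible probability measure $\nu$ on $[0,\infty)$ with $\nu(\{0\})=0$ such that $\pi^1_n*\dots*\pi_n^{m_n(\tau)}\to\nu^\tau$ weakly for all $\tau>0$. Then the weak limit $\rho=\lim_n\rho_n$ is geometrically infinitely divisible. (ii) Conversely, given any sequence $\{a_n\}$ in $(0,1)$ with $a_n\nearrow1$ and any geometrically infinitely divisible probability measure $\rho$ on $[0,\infty)$, there exists a row-constant array $\pi^m_n=\pi_n$ of probability measures on $(0,\infty)$ that is locally infinitesimal and for which $\rho=\lim_n\rho_n$ weakly.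
   Context: An array $\{\pi^m_n\}$ is locally infinitesimal if $\lim_{n}\sup_{m\le m_n(\tau)}\pi^m_n[\delta,\infty)=0$ for all $\tau,\delta>0$. $\nu^\tau$ is the $\tau$-th convolution power of an infinitely divisible $\nu$ (Laplace transform $(\hat\nu)^\tau$). Under the assumptions of (i), $\rho_n$ is known to converge weakly. A random variable $X$ (or its law) is geometrically infinitely divisible (GID) if for each $p\in(0,1)$ there is an i.i.d. sequence $\{X_m(p)\}_{m\in\mathbb{N}}$ such that $X$ has the same distribution as $\sum_{m=1}^{G(p)}X_m(p)$, where $G(p)$ is an $\mathbb{N}$-valued geometric random variable with success probability $p$ ($\mathbb{P}[G(p)=k]=p(1-p)^{k-1}$, $k\ge1$), independent of $\{X_m(p)\}_m$. Known fact: a probability measure $\rho$ on $[0,\infty)$ is GID if and only if $\hat\rho(\lambda)=1/(1-\log\hat\nu(\lambda))$ for some infinitely divisible probability measure $\nu$ on $[0,\infty)$, where $\hat{\ }$ is the Laplace transform. *)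

(* Defs.v *)
From HB Require Import structures.
From mathcomp Require Import all_boot all_order all_algebra.
From mathcomp Require Import finmap.
From mathcomp Require Import all_classical all_reals all_analysis measurable_realfun.

Set Implicit Arguments.
Unset Strict Implicit.
Unset Printing Implicit Defensive.

Import Order.TTheory GRing.Theory Num.Theory.
Import numFieldNormedType.Exports.

Local Open Scope classical_set_scope.
Local Open Scope ring_scope.

(* Borel probability measures on the real line.  Measures on [0, +oo[ or on
   ]0, +oo[ are those giving mass 1 to that interval. *)
Notation law R := (probability (measurableTypeR R) R).

Definition supported_on (R : realType) (A : set R) (mu : law R) : Prop :=
  mu A = 1%E.

Definition weak_cvg (R : realType) (mu_ : nat -> law R) (mu : law R) : Prop :=
  forall f : R -> R, continuous f -> (exists M, forall x, `|f x| <= M) ->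
    \int[mu_ n]_x f x @[n --> \oo] --> \int[mu]_x f x.

Section convolution.
Context (R : realType).
Local Notation RT := (measurableTypeR R).

Definition add_pair (z : RT * RT) : RT := (z.1 : R) + (z.2 : R).

Let measurable_add_pair : measurable_fun setT add_pair.
Proof. by apply: measurable_funD; [exact: measurable_fst|exact: measurable_snd]. Qed.

HB.instance Definition _ :=
  isMeasurableFun.Build _ _ _ _ add_pair measurable_add_pair.

Definition convolution (mu nu : law R) : law R :=
  distribution (mu \x nu)%E add_pair.

(* pi_ 1 * ... * pi_ k, equal to the Dirac mass at 0 for k = 0; pi_ 0 is unused *)
Fixpoint convolution_upto (pi_ : nat -> law R) (k : nat) : law R :=
  match k with
  | 0%N => dirac (0 : RT)
  | k'.+1 => convolution (convolution_upto pi_ k') (pi_ k'.+1)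
  end.

End convolution.

Definition infinitely_divisible (R : realType) (nu : law R) : Prop :=
  forall n : nat, (0 < n)%N -> exists mu : law R,
    forall A : set R, measurable A ->
      nu A = convolution_upto (fun=> mu) n A.

Definition laplace (R : realType) (mu : law R) (lambda : R) : R :=
  \int[mu]_(x in `[0, +oo[) expR (- (lambda * x)).

(* The tau-th convolution power of a law nu on [0, +oo[ is determined by its
   Laplace transform. *)
Definition is_convolution_power (R : realType) (nu : law R) (tau : R)
    (mu : law R) : Prop :=
  supported_on `[0, +oo[%classic mu /\
  forall lambda : R, 0 <= lambda ->
    laplace mu lambda = laplace nu lambda `^ tau.

Section geometric_mixture.
Context (R : realType) (a : R) (a01 : 0 < a < 1) (pi_ : nat -> law R).

Let a_ge0 : 0 <= a. Proof. by case/andP: a01 => /ltW. Qed.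
Let onema_ge0 : 0 <= 1 - a.
Proof. by case/andP: a01 => _ /ltW; rewrite subr_ge0. Qed.
Let aX_ge0 k : 0 <= a ^+ k. Proof. exact: exprn_ge0. Qed.

(* geometric_mixtureE gives the explicit formula *)
Definition geometric_mixture : set (measurableTypeR R) -> \bar R :=
  mscale (NngNum onema_ge0)
    (measure_add (dirac (0 : measurableTypeR R))
      (mseries (fun k => mscale (NngNum (aX_ge0 k)) (convolution_upto pi_ k)) 1)).

HB.instance Definition _ := Measure.on geometric_mixture.

Lemma geometric_mixtureE A : geometric_mixture A =
  ((1 - a)%:E * (\d_(0%R : measurableTypeR R) A
     + \sum_(1 <= k <oo) (a ^+ k)%:E * convolution_upto pi_ k A))%E.
Proof. by congr (_ * _)%E; exact: measure_addE. Qed.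

Let geometric_mixture_setT : geometric_mixture setT = 1%E.
Proof.
case/andP: a01 => a0 a1.
have ab1 : `|a| < 1 by rewrite ger0_norm // ltW.
have total : (\sum_(0 <= k <oo) (a ^+ k)%:E = ((1 - a)^-1)%:E)%E.
  have cv : series (geometric 1 a) @ \oo --> ((1 - a)^-1 : R).
    by have := @cvg_geometric_series R 1 a ab1; rewrite mul1r.
  rewrite -(cvg_lim _ cv)// -EFin_lim; last by apply/cvg_ex; exists (1 - a)^-1.
  congr (limn _); apply/funext => n /=.
  by rewrite seriesEnat sumEFin; congr (_%:E); apply: eq_bigr => k _; rewrite /= mul1r.
rewrite geometric_mixtureE diracT.
under eq_eseriesr do rewrite probability_setT mule1.
rewrite (_ : 1%E = (a ^+ 0)%:E)%E; last by rewrite expr0.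
rewrite -(nneseries_recl (P := xpredT) (f := fun k => (a ^+ k)%:E)) //;
  last by move=> k _; rewrite lee_fin.
by rewrite total expr0 -EFinM divff // subr_eq0 gt_eqF.
Qed.

HB.instance Definition _ := Measure_isProbability.Build _ _ _
  geometric_mixture geometric_mixture_setT.

Definition geometric_law : law R := geometric_mixture.

End geometric_mixture.

Definition steps (R : realType) (a tau : R) : nat :=
  `|Num.ceil (tau * (1 - a)^-1)|%N.

Definition locally_infinitesimal (R : realType) (a : nat -> R)
    (pi_ : nat -> nat -> law R) : Prop :=
  forall tau delta : R, 0 < tau -> 0 < delta ->
    ereal_sup [set pi_ n m `[delta, +oo[%classic |
                 m in [set m | (1 <= m <= steps (a n) tau)%N]]
      @[n --> \oo] --> 0%E.

Definition row_constant (R : realType) (pi_ : nat -> nat -> law R) : Prop :=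
  exists pi0_ : nat -> law R, forall n m : nat, (0 < m)%N -> pi_ n m = pi0_ n.

Section random_sequences.
Context (R : realType) (d : measure_display) (Omega : measurableType d)
  (P : probability Omega R).
Implicit Types (X : nat -> {RV P >-> measurableTypeR R}) (G : {RV P >-> nat}).

Definition mutually_independent X : Prop :=
  forall (J : {fset nat}) (B : nat -> set R),
    (forall i, measurable (B i)) ->
    P (\bigcap_(i in [set` J]) (X i @^-1` B i)) =
    (\big[*%E/1]_(i <- J) P (X i @^-1` B i))%E.

Definition identically_distributed X : Prop :=
  forall (i j : nat) (B : set R), measurable B ->
    distribution P (X i) B = distribution P (X j) B.

Definition sigma_of X : set (set Omega) :=
  <<s \bigcup_i preimage_set_system setT (X i) measurable >>.

Definition independent_of_sequence G X : Prop :=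
  forall (B : set nat) (A : set Omega), sigma_of X A ->
    P (G @^-1` B `&` A) = (P (G @^-1` B) * P A)%E.

Definition geometric_variable (p : R) G : Prop :=
  forall k : nat, (0 < k)%N ->
    P (G @^-1` [set k]) = (p * (1 - p) ^+ k.-1)%:E.

End random_sequences.

(* The i.i.d. sequence is indexed from 0, so that its first G w terms are
   X 0 w, ..., X (G w).-1 w. *)
Definition geometrically_infinitely_divisible (R : realType) (rho : law R) :
    Prop :=
  forall p : R, 0 < p < 1 ->
  exists (d : measure_display) (Omega : measurableType d)
    (P : probability Omega R)
    (X : nat -> {RV P >-> measurableTypeR R}) (G : {RV P >-> nat}),
    [/\ mutually_independent X,
        identically_distributed X,
        geometric_variable p G,
        independent_of_sequence G X
      & forall A : set R, measurable A ->
          rho A = P [set w | A (\sum_(i < G w) (X i w : R))]].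

(* Main.v *)
From HB Require Import structures.
Require Import Defs.
From mathcomp Require Import all_boot all_order all_algebra.
From mathcomp Require Import all_classical all_reals all_analysis measurable_realfun.
From mathcomp Require Import finmap ring lra.

Set Implicit Arguments.
Unset Strict Implicit.
Unset Printing Implicit Defensive.

Import Order.TTheory GRing.Theory Num.Theory.
Import numFieldNormedType.Exports.

Local Open Scope classical_set_scope.
Local Open Scope ring_scope.

(** The Laplace transform turns every law of the statement into an elementary
    expression.  If X has transform L, the sum of a geometric number G(p) of
    independent copies of X has transform p L / (1 - (1 - p) L), while the
    geometric law of a constant row with transform L has transform
    (1 - a) / (1 - a L).

    Converse part ([gid_is_geometric_limit]).  Use geometric infinite
    divisibility of rho with p = 1 - a_n: rho is a geometric sum of independent
    copies of some law mu_n, so that, with r the transform of rho, mu_n has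
    transform r / (p + (1 - p) r).  This tends to 1 as p tends to 0, and a Markov
    inequality makes the array infinitesimal.  The geometric law of the row mu_n
    has transform (1 - a_n) + a_n r, hence converges to rho.  Since mu_n may charge
    0, it is first shifted by (1 - a_n)^2, which is negligible against the mean
    number a_n / (1 - a_n) of summands.

    Direct part ([geometric_limit_is_gid]).  Write m_n(t) for [steps (a n) t].  Up
    to the mass 1 - a_n carried by the empty sum, the mean of f under rho_n is the
    integral over t > 0 of the step function
    a_n ^ m_n(t) times the mean of f under pi_n^1 * ... * pi_n^(m_n(t)).
    As a_n ^ m_n(t) tends to exp(-t) and is bounded by it, dominated convergence
    identifies the limit: it is the mixture rho of the powers nu^t with t exponential
    of rate 1, whose transform is 1 / (1 - log N), N being the transform of nu.  The
    mixture for an exponential time of rate 1 / p has transform 1 / (1 - p log N), and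
    a geometric sum of independent copies of it has the transform of rho, hence the
    law rho.

    Three general facts carry these arguments.  [laplace_cvg_weak_cvg] and
    [laplace_unique] say that pointwise convergence of transforms to the transform
    of a law is weak convergence, and that the transform determines the law; they
    rest on the approximation of continuous functions of exp(-x) by polynomials.
    [random_sum_law] expresses the law of a geometric sum through convolution
    powers.  [iid_geometric_exists] provides the independent copies: the binary
    digits of even rank and those of odd rank of a uniform variable form two
    independent uniform variables, so iterating the splitting gives a sequence. *)

(** * Weierstrass approximation *)

Section weierstrass.
Context (R : realType).

(** The Bernstein polynomial of h, that is the mean of h at a binomial variable.
    Conditioning on the first Bernoulli trial gives this recursion, for which the
    moments below are immediate inductions. *)
Fixpoint bernstein (n : nat) (h : nat -> R) : {poly R} :=
  if n is n'.+1 then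
    'X * bernstein n' (fun k => h k.+1) + (1 - 'X) * bernstein n' h
  else (h 0%N)%:P.

Lemma horner_bernsteinS n h (x : R) : (bernstein n.+1 h).[x] =
  x * (bernstein n (fun k => h k.+1)).[x] + (1 - x) * (bernstein n h).[x].
Proof. by rewrite /= !hornerE. Qed.

Lemma bernstein_affine n h (a b x : R) :
  (bernstein n (fun k => a + b * h k)).[x] = a + b * (bernstein n h).[x].
Proof.
elim: n h => [|n IH] h; first by rewrite /= !hornerE.
by rewrite !horner_bernsteinS (IH (fun k => h k.+1)) IH; ring.
Qed.

Lemma bernstein_le n (h h' : nat -> R) (x : R) : 0 <= x <= 1 ->
  (forall k, (k <= n)%N -> h k <= h' k) ->
  (bernstein n h).[x] <= (bernstein n h').[x].
Proof.
move=> /andP[x0 x1]; elim: n h h' => [|n IH] h h' hh'.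
  by rewrite /= !hornerE hh'.
rewrite !horner_bernsteinS lerD// ler_wpM2l// ?subr_ge0//; apply: IH => k kn.
  exact: hh'.
by apply: hh'; exact: leqW.
Qed.

(** The mean square distance to an arbitrary centre c, rather than to the mean, is
    what passes through the induction. *)
Lemma bernstein_variance n (c x : R) :
  (bernstein n (fun k => (k%:R - c) ^+ 2)).[x] =
  n%:R * x * (1 - x) + (n%:R * x - c) ^+ 2.
Proof.
elim: n c => [|n IH] c; first by rewrite /= !hornerE; ring.
rewrite horner_bernsteinS IH.
under [X in bernstein n X]eq_fun do rewrite -natr1 -addrA.
rewrite (_ : bernstein n _ = bernstein n (fun k => (k%:R - (c - 1)) ^+ 2)).
  by rewrite IH -natr1; ring.
by congr (bernstein n _); apply/funext => k; congr (_ ^+ 2); ring.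
Qed.

(** Heine: the bound holds near each point uniformly for all small radii, and
    compactness makes one radius valid everywhere. *)
Lemma uniformly_continuous01 (g : R -> R) (eps : R) : continuous g -> 0 < eps ->
  exists2 delta : R, 0 < delta &
    forall x y : R, 0 <= x <= 1 -> 0 <= y <= 1 -> `|x - y| < delta ->
      `|g x - g y| < eps.
Proof.
move=> gc e0.
have /compact_near_coveringP K : compact `[(0:R), 1] := @segment_compact R 0 1.
have := K R (0^'+) (fun d x => forall y, `|x - y| < d -> `|g x - g y| < eps) _.
case.
  move=> x _.
  have e20 : 0 < eps / 2 by rewrite divr_gt0.
  have /cvgrPdist_lt/(_ _ e20) := gc x.
  move=> /nbhs_ballP[d /= d0 dg].
  have d20 : 0 < d / 2 by rewrite divr_gt0.
  exists (ball x (d / 2), [set e | 0 < e < d / 2]); first split => /=.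
  - exact: nbhsx_ballx.
  - near=> e; apply/andP; split => //; near: e; exact: nbhs_right_lt.
  move=> [x' e] [/= x'x /andP[_ ed]] y x'y.
  have xx' : `|x - x'| < d / 2 by [].
  have gx' : `|g x - g x'| < eps / 2.
    apply: dg; rewrite /= /ball /=; apply: lt_trans xx' _.
    by rewrite gtr_pMr// invf_lt1// ltr1n.
  have gy : `|g x - g y| < eps / 2.
    apply: dg; rewrite /= /ball /= [ltRHS]splitr -(subrKA x').
    by rewrite (le_lt_trans (ler_normD _ _))// ltrD// (lt_trans x'y).
  rewrite -(subrKA (g x)) [ltRHS]splitr (le_lt_trans (ler_normD _ _))//.
  by rewrite ltrD// distrC.
move=> d /= d0 H.
exists (d / 2); first by rewrite divr_gt0.
move=> x y x01 y01 xy.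
apply: (H (d / 2)).
- by rewrite /ball/= sub0r normrN gtr0_norm ?divr_gt0// gtr_pMr// invf_lt1// ltr1n.
- by rewrite divr_gt0.
- by rewrite /= in_itv /=.
- by [].
Unshelve. all: by end_near. Qed.

(** Chebyshev's argument: the deviation of g from g x is small near x and elsewhere
    at most a multiple of the squared distance to x, whose mean is at most C / n. *)
Lemma weierstrass_approximation (g : R -> R) (eps : R) : continuous g -> 0 < eps ->
  exists P : {poly R}, forall x : R, 0 <= x <= 1 -> `|P.[x] - g x| <= eps.
Proof.
move=> gc e0.
have e20 : 0 < eps / 2 by rewrite divr_gt0.
have [d d0 gd] := uniformly_continuous01 gc e20.
have [M M0 gM] : exists2 M : R, 0 <= M & forall x : R, 0 <= x <= 1 -> `|g x| <= M.
  have ag : {within `[0, 1], continuous (fun x => `|g x|)}.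
    by apply: continuous_subspaceT => x; apply: cvg_norm; exact: gc.
  have [c _ cM] := EVT_max ler01 ag.
  by exists `|g c| => // x x01; apply: cM; rewrite in_itv /=.
(* beyond distance d, the bound 2 M on the deviation is at most C times the
   squared distance *)
pose C := 2 * M / d ^+ 2.
have C0 : 0 <= C by apply: divr_ge0; [exact: mulr_ge0|apply: exprn_ge0; exact: ltW].
pose n := (Num.truncn (C / (eps / 2))).+1.
have n0 : 0 < n%:R :> R by rewrite ltr0n.
have Cn : C / n%:R <= eps / 2.
  rewrite ler_pdivrMr// mulrC -ler_pdivrMr//.
  by apply: ltW; rewrite truncnS_gt// divr_ge0// ltW.
exists (bernstein n (fun k => g (k%:R / n%:R))) => x x01.
have /andP[x0 x1] := x01.
have dev k : (k <= n)%N ->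
    `|g (k%:R / n%:R) - g x| <= eps / 2 + C / n%:R ^+ 2 * (k%:R - n%:R * x) ^+ 2.
  move=> kn.
  have k01 : 0 <= (k%:R / n%:R : R) <= 1.
    by rewrite divr_ge0//= ler_pdivrMr// mul1r ler_nat.
  have -> : C / n%:R ^+ 2 * (k%:R - n%:R * x) ^+ 2 = C * (k%:R / n%:R - x) ^+ 2.
    have nN0 : n%:R != 0 :> R by rewrite gt_eqF.
    by field.
  have [xd|xd] := ltP `|k%:R / n%:R - x| d.
    by rewrite (le_trans (ltW (gd _ _ k01 x01 xd)))// lerDl mulr_ge0// sqr_ge0.
  apply: (@le_trans _ _ (2 * M)).
    by rewrite (le_trans (ler_normB _ _))// mulrDl mul1r lerD// gM.
  rewrite -[leLHS]add0r lerD//; first exact: ltW.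
  rewrite /C mulrAC ler_pdivlMr ?exprn_gt0// ler_wpM2l ?mulr_ge0//.
  by rewrite -[leRHS]real_normK ?num_real// lerXn2r// nnegrE// ltW.
have bnd : (bernstein n (fun k => eps / 2 + C / n%:R ^+ 2 * (k%:R - n%:R * x) ^+ 2)).[x]
    <= eps.
  rewrite bernstein_affine bernstein_variance subrr expr0n/= addr0.
  rewrite [leRHS]splitr lerD2l (le_trans _ Cn)//.
  have -> : C / n%:R ^+ 2 * (n%:R * x * (1 - x)) = C / n%:R * (x * (1 - x)).
    have nN0 : n%:R != 0 :> R by rewrite gt_eqF.
    by field.
  rewrite ler_piMr ?divr_ge0//; nra.
rewrite ler_norml; apply/andP; split; rewrite (lerBrDl, lerBlDl).
  apply: le_trans (lerB (lexx (g x)) bnd) _.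
  have := bernstein_affine n (fun k => eps / 2 + C / n%:R ^+ 2 * (k%:R - n%:R * x) ^+ 2)
    (g x) (-1) x.
  rewrite mulN1r => <-; apply: bernstein_le => // k kn.
  by have := dev k kn; rewrite ler_distl mulN1r => /andP[].
apply: le_trans _ (lerD (lexx (g x)) bnd).
have := bernstein_affine n (fun k => eps / 2 + C / n%:R ^+ 2 * (k%:R - n%:R * x) ^+ 2)
  (g x) 1 x.
rewrite mul1r => <-; apply: bernstein_le => // k kn.
by rewrite mul1r; have := dev k kn; rewrite ler_distl => /andP[].
Qed.
End weierstrass.

(** * Laplace transforms and weak convergence *)

Section bounded_expectation.
Context (R : realType) (mu : law R).
Local Notation RT := (measurableTypeR R).
Implicit Types f g : R -> R.

Lemma integrable_bounded f (M : R) : measurable_fun [set: RT] (f : RT -> R) ->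
  (forall x, `|f x| <= M) -> mu.-integrable [set: RT] (EFin \o f).
Proof.
move=> mf fM; apply: measurable_bounded_integrable => //.
  by rewrite (le_lt_trans (probability_le1 _ _))// ltry.
exists M; split; first exact: num_real.
by move=> M' MM' x _ /=; rewrite (le_trans (fM x))// ltW.
Qed.

Lemma le_dist_expectation f g h (M : R) :
  measurable_fun [set: RT] (f : RT -> R) -> measurable_fun [set: RT] (g : RT -> R) ->
  measurable_fun [set: RT] (h : RT -> R) ->
  (forall x, `|f x| <= M) -> (forall x, `|g x| <= M) -> (forall x, `|h x| <= M) ->
  (forall x, `|f x - g x| <= h x) ->
  `|\int[mu]_x f x - \int[mu]_x g x| <= \int[mu]_x h x.
Proof.
move=> mf mg mh fM gM hM fgh.
have jf := integrable_bounded mf fM.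
have jg := integrable_bounded mg gM.
have jh := integrable_bounded mh hM.
have jfg : mu.-integrable [set: RT] (EFin \o (fun x => f x - g x)).
  by have := integrableB measurableT jf jg; apply: eq_integrable.
rewrite -RintegralB//; apply: le_trans (le_normr_Rintegral _ jfg) _ => //.
apply: le_Rintegral => //.
by have := integrable_abse jfg; apply: eq_integrable.
Qed.

Lemma prob_mean_cst (c : R) : \int[mu]_x c = c.
Proof. by rewrite /Rintegral integral_cst//= probability_setT mule1. Qed.

Lemma supported_setC (A : set RT) : measurable A -> supported_on A mu -> mu (~` A) = 0%E.
Proof. by move=> mA sA; rewrite probability_setC// sA subee. Qed.

Lemma supported_integral (A : set RT) (f : RT -> \bar R) : measurable A ->
  supported_on A mu -> measurable_fun [set: RT] f -> (forall x, 0 <= f x)%E ->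
  (\int[mu]_(x in A) f x = \int[mu]_x f x)%E.
Proof.
move=> mA sA mf f0; rewrite [RHS](@ge0_negligible_integral _ _ _ _ _ (~` A))//.
- by rewrite setDE setCK setTI.
- exact: measurableC.
- exact: supported_setC.
Qed.

Lemma supported_Rintegral (A : set RT) f (M : R) : measurable A ->
  supported_on A mu -> measurable_fun [set: RT] (f : RT -> R) ->
  (forall x, `|f x| <= M) -> \int[mu]_(x in A) f x = \int[mu]_x f x.
Proof.
move=> mA sA mf fM; rewrite /Rintegral.
rewrite [in RHS](@negligible_integral _ _ _ _ _ (~` A))//.
- by rewrite setDE setCK setTI.
- exact: measurableC.
- exact: integrable_bounded fM.
- exact: supported_setC.
Qed.

Lemma supported_subset (A B : set RT) : measurable A -> measurable B ->
  A `<=` B -> supported_on A mu -> supported_on B mu.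
Proof.
move=> mA mB AB sA; apply/eqP; rewrite eq_le probability_le1//= -sA.
by apply: le_measure => //; exact: mem_set.
Qed.

Lemma setC_supported (A : set RT) : measurable A -> mu (~` A) = 0%E -> supported_on A mu.
Proof.
move=> mA A0; rewrite /supported_on -[A]setCK.
by rewrite [LHS]probability_setC ?A0 ?sube0//; exact: measurableC.
Qed.

End bounded_expectation.

Section laplace_weak.
Context (R : realType).
Local Notation RT := (measurableTypeR R).
Local Notation pos := (fun x : R => Num.max x 0).

Lemma measurable_continuous (f : R -> R) : continuous f ->
  measurable_fun [set: RT] (f : RT -> R).
Proof. exact: continuous_measurable_fun. Qed.

Lemma continuous_maxl (a : R) : continuous (fun x : R => Num.max x a).
Proof. by move=> x; apply: continuous_max; [exact: cvg_id|exact: cvg_cst]. Qed.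

Lemma continuous_minl (a : R) : continuous (fun x : R => Num.min x a).
Proof. by move=> x; apply: continuous_min; [exact: cvg_id|exact: cvg_cst]. Qed.

Lemma continuous_expRN (l : R) : continuous (fun x : R => expR (- (l * x))).
Proof.
move=> x; apply: continuous_comp; last exact: continuous_expR.
by apply: continuousN; apply: cvgM; [exact: cvg_cst|exact: cvg_id].
Qed.

(** Freezing the kernel at 0 on the negative half-line makes it bounded and
    continuous, so that the transform of a law on the half-line is the mean of a
    test function for weak convergence. *)
Definition expm (l x : R) : R := expR (- (l * pos x)).

Lemma expm_gt0 l x : 0 < expm l x. Proof. exact: expR_gt0. Qed.

Lemma expm_le1 l x : 0 <= l -> expm l x <= 1.
Proof.
by move=> l0; rewrite -expR0 ler_expR oppr_le0 mulr_ge0// le_max lexx orbT.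
Qed.

Lemma norm_expm l x : 0 <= l -> `|expm l x| <= 1.
Proof. by move=> l0; rewrite ger0_norm ?expm_le1// ltW// expm_gt0. Qed.

Lemma continuous_expm l : continuous (expm l).
Proof.
move=> x; apply: (@continuous_comp _ _ _ pos (fun x : R => expR (- (l * x)))).
  exact: continuous_maxl.
exact: continuous_expRN.
Qed.

Lemma measurable_expm l : measurable_fun [set: RT] (expm l : RT -> R).
Proof. exact: measurable_continuous (@continuous_expm l). Qed.

Lemma integrable_expm (mu : law R) l : 0 <= l -> mu.-integrable [set: RT] (EFin \o expm l).
Proof.
move=> l0; apply: (@integrable_bounded _ _ _ 1) => [|x]; last exact: norm_expm.
exact: measurable_expm.
Qed.

Lemma laplaceE (mu : law R) l : supported_on `[0, +oo[ mu -> 0 <= l ->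
  laplace mu l = \int[mu]_x expm l x.
Proof.
move=> smu l0; rewrite -(@supported_Rintegral R mu `[0, +oo[%classic _ 1)//.
- apply: eq_Rintegral => x /set_mem; rewrite /= in_itv/= andbT => x0.
  by rewrite /expm max_l.
- exact: measurable_expm.
- by move=> x; exact: norm_expm.
Qed.

Lemma expectation_horner (mu : law R) (P : {poly R}) : supported_on `[0, +oo[ mu ->
  \int[mu]_x P.[expm 1 x] = \sum_(i < size P) P`_i * laplace mu i%:R.
Proof.
move=> smu; under eq_Rintegral do rewrite horner_coef.
elim: (size P) => [|n IH].
  rewrite big_ord0; under eq_Rintegral do rewrite big_ord0.
  exact: prob_mean_cst.
rewrite [RHS]big_ord_recr/= -IH.
rewrite (_ : (fun x => _) = (fun x : R => \sum_(i < n) P`_i * expm 1 x ^+ i +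
    P`_n * expm 1 x ^+ n)); last by apply/funext => x; rewrite big_ord_recr.
have E k (x : R) : expm 1 x ^+ k = expm k%:R x.
  by rewrite /expm -expRM_natl mul1r mulrN mulr_natl.
have ie k : mu.-integrable [set: RT] (EFin \o (fun x => P`_k * expm 1 x ^+ k)).
  have := integrableZl measurableT (P`_k) (integrable_expm mu (ler0n R k)).
  by apply: eq_integrable => // x _; rewrite /= E EFinM.
have is_ : mu.-integrable [set: RT]
    (EFin \o (fun x => \sum_(i < n) P`_i * expm 1 x ^+ i)).
  have := @integrable_sum _ _ _ mu setT measurableT _ (index_enum 'I_n) xpredT
    (fun i x => (P`_i * expm 1 x ^+ i)%:E) (fun i _ => ie i).
  by apply: eq_integrable => // x _; rewrite /= -sumEFin.
rewrite RintegralD//; congr (_ + _).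
under eq_Rintegral do rewrite E.
rewrite laplaceE//; apply: RintegralZl => //; exact: integrable_expm.
Qed.

(** Functions of exp(-x) are uniform limits of polynomials in exp(-x), and the mean
    of such a polynomial is a combination of values of the transform at integers. *)
Lemma laplace_cvg_compactified (mu_ : nat -> law R) (mu : law R) (g : R -> R) :
  (forall n, supported_on `[0, +oo[ (mu_ n)) -> supported_on `[0, +oo[ mu ->
  (forall k : nat, laplace (mu_ n) k%:R @[n --> \oo] --> laplace mu k%:R) ->
  continuous g ->
  \int[mu_ n]_x g (expm 1 x) @[n --> \oo] --> \int[mu]_x g (expm 1 x).
Proof.
move=> smu_ smu cvL gc; apply/cvgrPdist_lt => e e0.
have e30 : 0 < e / 3 by rewrite divr_gt0.
have [P Pg] := weierstrass_approximation gc e30.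
have expm01 x : 0 <= expm 1 x <= 1 by rewrite (ltW (expm_gt0 _ _)) expm_le1.
have [M gM] : exists M : R, forall x, `|g (expm 1 x)| <= M.
  have ag : {within `[0, 1], continuous (fun x => `|g x|)}.
    by apply: continuous_subspaceT => x; apply: cvg_norm; exact: gc.
  have [c _ cM] := EVT_max ler01 ag.
  by exists `|g c| => x; apply: cM; rewrite in_itv/=.
have dist (nu : law R) :
    `|\int[nu]_x g (expm 1 x) - \int[nu]_x P.[expm 1 x]| <= e / 3.
  rewrite -[leRHS](prob_mean_cst nu).
  apply: (@le_dist_expectation _ _ _ _ _ (M + e / 3)).
  - apply: measurable_continuous => x.
    by apply: continuous_comp; [exact: continuous_expm|exact: gc].
  - apply: measurable_continuous => x.
    apply: (@continuous_comp _ _ _ _ (horner P)); first exact: continuous_expm.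
    exact: continuous_horner.
  - exact: measurable_cst.
  - by move=> x; rewrite (le_trans (gM x))// lerDl ltW.
  - move=> x; rewrite -[X in `|X|](subrK (g (expm 1 x))) addrC.
    by rewrite (le_trans (ler_normD _ _))// lerD// Pg.
  - move=> x; rewrite ger0_norm; last exact: ltW.
    rewrite lerDr.
    by rewrite (le_trans (normr_ge0 _) (gM 0)).
  - by move=> x; rewrite distrC Pg.
have : \int[mu_ n]_x P.[expm 1 x] @[n --> \oo] --> \int[mu]_x P.[expm 1 x].
  rewrite expectation_horner//.
  under eq_fun do rewrite expectation_horner//.
  apply: cvg_big => [|i _]; first exact: add_continuous.
  by apply: cvgM; [exact: cvg_cst|exact: cvL].
move=> /cvgrPdist_lt/(_ _ e30); apply: filterS => n Pn.
have := dist (mu_ n); have := dist mu; move: Pn.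
set a := \int[mu]_x _; set b := \int[mu_ n]_x _; set c := \int[mu]_x _.
set d := \int[mu_ n]_x _.
rewrite ltr_norml !ler_norml ltr_norml => /andP[? ?] /andP[? ?] /andP[? ?].
by apply/andP; split; lra.
Qed.


(** A function frozen beyond K is a function of exp(-x), see [clamp_expm]. *)
Definition clamp (K x : R) : R := Num.min (pos x) K.
(** A test function between the indicators of [K + 1, +oo[ and ]K, +oo[, frozen
    beyond K + 1: it controls the mass that [clamp] disregards. *)
Definition ramp (K x : R) : R := Num.max (clamp (K + 1) x - K) 0.

Lemma continuous_clamp K : continuous (clamp K).
Proof.
move=> x; apply: (@continuous_comp _ _ _ pos (fun x => Num.min x K)).
  exact: continuous_maxl.
exact: continuous_minl.
Qed.

Lemma continuous_ramp K : continuous (ramp K).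
Proof.
move=> x; apply: (@continuous_comp _ _ _ (fun x => clamp (K + 1) x - K) pos).
  by apply: continuousB; [exact: continuous_clamp|exact: cvg_cst].
exact: continuous_maxl.
Qed.

Lemma ramp01 K x : 0 <= ramp K x <= 1.
Proof.
rewrite /ramp le_max lexx orbT ge_max ler01 andbT/=.
by rewrite lerBlDl ge_min lexx orbT.
Qed.

Lemma clamp_expm K x : 0 <= K ->
  clamp K x = - ln (Num.max (expm 1 x) (expR (- K))).
Proof.
move=> K0; rewrite /clamp /expm mul1r.
have [xK|xK] := leP (pos x) K.
  by rewrite (@max_l _ _ (expR _)) ?ler_expR ?lerN2// expRK opprK.
by rewrite (@max_r _ _ (expR _)) ?expRK ?opprK// ler_expR lerN2 ltW.
Qed.

Lemma cvg_clamp (mu_ : nat -> law R) (mu : law R) (f : R -> R) K : 0 <= K ->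
  (forall n, supported_on `[0, +oo[ (mu_ n)) -> supported_on `[0, +oo[ mu ->
  (forall k : nat, laplace (mu_ n) k%:R @[n --> \oo] --> laplace mu k%:R) ->
  continuous f ->
  \int[mu_ n]_x f (clamp K x) @[n --> \oo] --> \int[mu]_x f (clamp K x).
Proof.
move=> K0 smu_ smu cvL fc.
pose g (y : R) := f (- ln (Num.max y (expR (- K)))).
have gc : continuous g.
  move=> y; apply: (@continuous_comp _ _ _ (fun y => - ln (Num.max y (expR (- K)))) f);
    last exact: fc.
  apply: continuousN; apply: (@continuous_comp _ _ _ (fun y => Num.max y (expR (- K))) (@ln R)).
    exact: continuous_maxl.
  by apply: continuous_ln; rewrite lt_max expR_gt0 orbT.
have E (nu : law R) : \int[nu]_x f (clamp K x) = \int[nu]_x g (expm 1 x).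
  by apply: eq_Rintegral => x _; rewrite clamp_expm.
rewrite E; under eq_fun do rewrite E.
exact: laplace_cvg_compactified.
Qed.

Lemma expectation_ramp_cvg0 (mu : law R) :
  \int[mu]_x ramp n%:R x @[n --> \oo] --> (0 : R).
Proof.
have mr (n : nat) : measurable_fun [set: RT] (ramp n%:R : RT -> R).
  exact: measurable_continuous (@continuous_ramp _).
have nr (n : nat) x : `|ramp n%:R x| <= 1.
  by case/andP: (ramp01 n%:R x) => r0 r1; rewrite ger0_norm.
have cv : (\int[mu]_x (ramp n%:R x)%:E)%E @[n --> \oo] --> (\int[mu]_x (cst 0 x))%E.
  apply: (@dominated_cvg _ _ _ mu setT measurableT
    (fun n x => (ramp n%:R x)%:E) (cst 0%E) (cst 1%E)).
  - by move=> n; apply/measurable_EFinP.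
  - move=> x _; apply: cvg_near_cst.
    near=> n; congr (_%:E); rewrite /ramp max_r//.
    rewrite subr_le0 /clamp ge_min ge_max ler0n andbT.
    by apply/orP; left; near: n; exact: nbhs_infty_ger.
  - by [].
  - by apply: (@integrable_bounded _ _ (cst 1) 1) => // x; rewrite normr1.
  - by move=> n x _; rewrite /= lee_fin nr.
rewrite integral0 in cv.
exact: fine_cvg cv.
Unshelve. all: by end_near. Qed.

(** Tightness comes for free because the limit is a law: the mass of mu_ n beyond K
    is controlled by the mean of [ramp K], which converges to its mean under mu, and
    the latter is small for K large. *)
Theorem laplace_cvg_weak_cvg (mu_ : nat -> law R) (mu : law R) :
  (forall n, supported_on `[0, +oo[ (mu_ n)) -> supported_on `[0, +oo[ mu ->
  (forall k : nat, laplace (mu_ n) k%:R @[n --> \oo] --> laplace mu k%:R) ->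
  weak_cvg mu_ mu.
Proof.
move=> smu_ smu cvL f fc [M fM]; apply/cvgrPdist_lt => e e0.
have M0 : 0 <= M by rewrite (le_trans (normr_ge0 _) (fM 0)).
have pc : continuous (fun x => f (pos x)).
  by move=> x; apply: (@continuous_comp _ _ _ pos f); [exact: continuous_maxl|exact: fc].
have Epos (nu : law R) : supported_on `[0, +oo[ nu ->
    \int[nu]_x f x = \int[nu]_x f (pos x).
  move=> snu; rewrite -(@supported_Rintegral R nu `[0, +oo[%classic f M)//; last first.
    exact: measurable_continuous.
  rewrite -(@supported_Rintegral R nu `[0, +oo[%classic (fun x => f (pos x)) M)//;
    last exact: measurable_continuous.
  by apply: eq_Rintegral => x /set_mem; rewrite /= in_itv/= andbT => x0; rewrite max_l.
(* the errors are 2 M d for each of the two clampings and d for the clamped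
   means; the + 1 only guards against M = 0 *)
pose d := e / (4 * M + 1).
have d0 : 0 < d by rewrite divr_gt0// ltr_wpDl// mulr_ge0.
have [K rK] : exists K : nat, \int[mu]_x ramp K%:R x < d.
  have /cvgrPdist_lt/(_ _ d0)[K _ /(_ K (leqnn _))/=] := expectation_ramp_cvg0 mu.
  by rewrite sub0r normrN => /(le_lt_trans (ler_norm _)); exists K.
have K0 : 0 <= K%:R + 1 :> R by rewrite addr_ge0.
have dist (nu : law R) : `|\int[nu]_x f (pos x) - \int[nu]_x f (clamp (K%:R + 1) x)|
    <= 2 * M * \int[nu]_x ramp K%:R x.
  rewrite -RintegralZl//; last first.
    apply: (@integrable_bounded _ _ _ 1).
      exact: measurable_continuous (@continuous_ramp _).
    by move=> x; case/andP: (ramp01 K%:R x) => r0 r1; rewrite ger0_norm.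
  apply: (@le_dist_expectation _ _ _ _ _ (2 * M)).
  - exact: measurable_continuous.
  - apply: measurable_continuous => x.
    by apply: (@continuous_comp _ _ _ (clamp _) f); [exact: continuous_clamp|exact: fc].
  - apply: measurable_continuous => x.
    by apply: cvgM; [exact: cvg_cst|exact: continuous_ramp].
  - by move=> x; rewrite (le_trans (fM _))// ler_peMl// ler1n.
  - by move=> x; rewrite (le_trans (fM _))// ler_peMl// ler1n.
  - move=> x; case/andP: (ramp01 K%:R x) => r0 r1.
    by rewrite ger0_norm ?mulr_ge0// ler_piMr// mulr_ge0.
  - move=> x; have [xK|xK] := leP (pos x) (K%:R + 1).
      rewrite /clamp min_l// subrr normr0 mulr_ge0 ?mulr_ge0//.
      by case/andP: (ramp01 K%:R x).
    have -> : ramp K%:R x = 1.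
      by rewrite /ramp /clamp min_r ?(ltW xK)// addrAC subrr add0r max_l.
    rewrite mulr1.
    by rewrite (le_trans (ler_normB _ _))// mulrDl mul1r lerD// fM.
have rcv : \int[mu_ n]_x ramp K%:R x @[n --> \oo] --> \int[mu]_x ramp K%:R x.
  have rc : continuous (fun y : R => Num.max (y - K%:R) 0).
    move=> y; apply: (@continuous_comp R R R (fun y : R => y - K%:R : R) pos).
      by apply: continuousB; [exact: cvg_id|exact: cvg_cst].
    exact: continuous_maxl.
  exact: cvg_clamp K0 smu_ smu cvL rc.
have near1 : \forall n \near \oo, \int[mu_ n]_x ramp K%:R x < d.
  exact: (cvgr_lt _ rcv).
have near2 : \forall n \near \oo, `|\int[mu]_x f (clamp (K%:R + 1) x) -
    \int[mu_ n]_x f (clamp (K%:R + 1) x)| < d.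
  by have /cvgrPdist_lt/(_ _ d0) := cvg_clamp K0 smu_ smu cvL fc.
near=> n.
have n1 : \int[mu_ n]_x ramp K%:R x < d by near: n.
have n2 : `|\int[mu]_x f (clamp (K%:R + 1) x) -
    \int[mu_ n]_x f (clamp (K%:R + 1) x)| < d by near: n.
rewrite !Epos//.
have := le_trans (dist mu) (ler_wpM2l _ (ltW rK)).
have := le_trans (dist (mu_ n)) (ler_wpM2l _ (ltW n1)).
have -> : e = 4 * M * d + d by rewrite /d; field; rewrite gt_eqF// ltr_wpDl// mulr_ge0.
have M2 : 0 <= 2 * M by rewrite mulr_ge0.
move=> /(_ M2) + /(_ M2); move: n2.
have Md : 0 <= M * d by rewrite mulr_ge0// ltW.
set a := \int[mu]_x _; set b := \int[mu_ n]_x _; set c := \int[mu_ n]_x _.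
set g := \int[mu]_x _.
rewrite !ltr_norml !ler_norml -!mulrA => /andP[? ?] /andP[? ?] /andP[? ?].
by apply/andP; split; lra.
Unshelve. all: by end_near. Qed.

End laplace_weak.

(** * Laws are determined by their Laplace transform *)

Section uniqueness.
Context (R : realType).
Local Notation RT := (measurableTypeR R).

Lemma eq_measure_rays (m1 m2 : {measure set RT -> \bar R}) :
  (forall x : R, m1 `]x, +oo[%classic = m2 `]x, +oo[%classic) ->
  (forall x : R, m1 `]x, +oo[%classic < +oo)%E ->
  forall A, measurable A -> m1 A = m2 A.
Proof.
move=> m12 m1oo A mA.
apply: (@measure_unique _ R RT (@RGenOInfty.G R) (fun n => `](- n%:R : R), +oo[%classic)) => //.
- exact: RGenOInfty.measurableE.
- move=> _ _ [x ->] [y ->]; exists (Num.max x y).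
  by rewrite predeqE => z /=; rewrite !in_itv/= !andbT gt_max; split => [[-> ->]|/andP[]].
- by move=> n; exists (- n%:R).
- rewrite -subTset => x _; exists (Num.truncn `|x|).+1 => //=.
  rewrite in_itv/= andbT ltrNl (le_lt_trans (ler_norm _))// normrN.
  exact: truncnS_gt.
- by move=> _ [x ->].
Qed.

Definition step_up (x : R) (n : nat) (y : R) : R :=
  Num.min (Num.max ((y - x) * n%:R) 0) 1.

Lemma continuous_step_up x n : continuous (step_up x n).
Proof.
move=> y; apply: (@continuous_comp R R R (fun y : R => Num.max ((y - x) * n%:R) 0)
  (fun z : R => Num.min z 1)); last exact: continuous_minl.
apply: (@continuous_comp R R R (fun y : R => (y - x) * n%:R) (fun z : R => Num.max z 0));
  last exact: continuous_maxl.
apply: cvgM; last exact: cvg_cst.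
by apply: cvgB; [exact: cvg_id|exact: cvg_cst].
Qed.

Lemma step_up01 x n y : 0 <= step_up x n y <= 1.
Proof. by rewrite /step_up ge_min lexx orbT andbT le_min ler01 le_max lexx orbT. Qed.

Lemma cvg_step_up x y :
  step_up x n y @[n --> \oo] --> (\1_(`]x, +oo[%classic) y : R).
Proof.
apply: cvg_near_cst; rewrite indicE; have [xy|yx] := ltP x y.
  rewrite mem_set/= ?in_itv/= ?xy//.
  near=> n; rewrite /step_up min_r// le_max; apply/orP; left.
  rewrite mulrC -ler_pdivrMr ?subr_gt0//.
  by near: n; exact: nbhs_infty_ger.
rewrite memNset/= ?in_itv/= ?andbT; last by apply/negP; rewrite -leNgt.
near=> n; rewrite /step_up max_r ?min_l//.
by rewrite mulr_le0_ge0// subr_le0.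
Unshelve. all: by end_near. Qed.

(** The continuous functions [step_up x n] increase to the indicator of ]x, +oo[. *)
Lemma integral_ray (mu : law R) x :
  (\int[mu]_y (step_up x n y)%:E @[n --> \oo] --> mu `]x, +oo[%classic)%E.
Proof.
have -> : mu `]x, +oo[%classic = (\int[mu]_y (\1_(`]x, +oo[%classic) y)%:E)%E.
  by rewrite integral_indic// setIT.
apply: (@dominated_cvg _ _ _ mu setT measurableT
    (fun n y => (step_up x n y)%:E) _ (cst 1%E)) => //.
- move=> n; apply/measurable_EFinP; apply: measurable_continuous.
  exact: continuous_step_up.
- by move=> y _; apply: cvg_EFin; [exact: nearW|exact: cvg_step_up].
- by apply: (@integrable_bounded _ _ (cst 1) 1) => // y; rewrite normr1.
- by move=> n y _; case/andP: (step_up01 x n y) => s0 s1; rewrite /= lee_fin ger0_norm.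
Qed.

Lemma eq_law_continuous (mu nu : law R) :
  (forall f : R -> R, continuous f -> (exists M, forall x, `|f x| <= M) ->
    \int[mu]_x f x = \int[nu]_x f x) ->
  forall A : set RT, measurable A -> mu A = nu A.
Proof.
move=> mn; apply: eq_measure_rays => [x|x]; last first.
  by rewrite (le_lt_trans (probability_le1 _ _))// ltry.
have bs n y : `|step_up x n y| <= 1.
  by case/andP: (step_up01 x n y) => s0 s1; rewrite ger0_norm.
have := @integral_ray nu x; have := @integral_ray mu x.
suff -> : (fun n => \int[mu]_y (step_up x n y)%:E)%E =
    (fun n => \int[nu]_y (step_up x n y)%:E)%E by exact: cvg_unique.
apply/funext => n.
have fin (la : law R) : (\int[la]_y (step_up x n y)%:E)%E \is a fin_num.
  apply: integrable_fin_num => //.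
  apply: (@integrable_bounded _ _ _ 1) => //.
  by apply: measurable_continuous; exact: continuous_step_up.
rewrite -(fineK (fin mu)) -(fineK (fin nu)); congr (_%:E).
by apply: mn; [exact: continuous_step_up|exists 1].
Qed.

Lemma weak_cvg_cst_eq (mu nu : law R) : weak_cvg (fun=> mu) nu ->
  forall A : set RT, measurable A -> mu A = nu A.
Proof.
move=> w; apply: eq_law_continuous => f fc fb.
by apply/esym/(@cvg_unique _ _ _ _ _ _ (w f fc fb)) => //; exact: cvg_cst.
Qed.

Lemma laplace_unique (mu nu : law R) :
  supported_on `[0, +oo[ mu -> supported_on `[0, +oo[ nu ->
  (forall k : nat, laplace mu k%:R = laplace nu k%:R) ->
  forall A : set RT, measurable A -> mu A = nu A.
Proof.
move=> smu snu E; apply/weak_cvg_cst_eq/laplace_cvg_weak_cvg => // k.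
by rewrite E; exact: cvg_cst.
Qed.

End uniqueness.

(** * Transforms of convolutions and of geometric mixtures *)

Section convolution_laplace.
Context (R : realType).
Local Notation RT := (measurableTypeR R).
Implicit Types mu nu : law R.

(** Integrating over the whole line with extended values makes the transform
    multiplicative for all laws, by Tonelli alone. *)
Definition elaplace (mu : law R) (l : R) : \bar R :=
  (\int[mu]_x (expR (- (l * x)))%:E)%E.

Lemma measurable_expRN (l : R) :
  measurable_fun [set: RT] (fun x : RT => (expR (- (l * (x : R))))%:E).
Proof.
apply/measurable_EFinP; apply: (@measurable_continuous R (fun x : R => expR (- (l * x)))).
exact: continuous_expRN.
Qed.

Lemma elaplaceE mu l : supported_on `[0, +oo[ mu -> 0 <= l ->
  elaplace mu l = (laplace mu l)%:E.
Proof.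
move=> smu l0; rewrite /elaplace -(@supported_integral _ mu `[0, +oo[%classic)//.
- rewrite /laplace /Rintegral fineK//.
  rewrite (@eq_integral _ RT _ _ _ (EFin \o expm l)); last first.
    move=> x /set_mem; rewrite /= in_itv/= andbT => x0.
    by rewrite /expm max_l.
  rewrite (@supported_integral R mu `[0, +oo[%classic)//.
  + by apply: integrable_fin_num => //; exact: integrable_expm.
  + by apply/measurable_EFinP; exact: measurable_expm.
  + by move=> x; rewrite lee_fin expR_ge0.
- exact: measurable_expRN.
Qed.

Lemma laplace_ge0 mu l : 0 <= laplace mu l.
Proof. by apply: Rintegral_ge0 => x _; exact: expR_ge0. Qed.

Lemma laplace_gt0 mu l : supported_on `[0, +oo[ mu -> 0 <= l -> 0 < laplace mu l.
Proof.
move=> smu l0; rewrite lt_neqAle laplace_ge0 andbT eq_sym; apply/negP => /eqP L0.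
have := elaplaceE smu l0; rewrite L0 /elaplace => I0.
have /(ae_eq_integral_abs mu measurableT (measurable_expRN l)).1 :
    (\int[mu]_x `|(expR (- (l * x)))%:E| = 0)%E.
  rewrite -[RHS]I0; apply: eq_integral => x _.
  by rewrite gee0_abs// lee_fin expR_ge0.
move=> [N [mN N0 sN]]; have : mu setT = 0%E.
  apply/eqP; rewrite eq_le measure_ge0 andbT -N0; apply: le_measure => //; try exact: mem_set.
  move=> x _; apply: sN => /= /(_ I) /eqP; rewrite eqe gt_eqF//.
  exact: expR_gt0.
by rewrite probability_setT => /eqP; rewrite eqe oner_eq0.
Qed.

Lemma laplace_le1 mu l : supported_on `[0, +oo[ mu -> 0 <= l -> laplace mu l <= 1.
Proof.
move=> smu l0; rewrite laplaceE// -[leRHS](prob_mean_cst mu).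
apply: le_Rintegral => //; first exact: integrable_expm.
  by apply: (@integrable_bounded _ _ (cst 1) 1) => // x; rewrite normr1.
by move=> x _; exact: expm_le1.
Qed.

Lemma elaplace_convolution mu nu l :
  elaplace (convolution mu nu) l = (elaplace mu l * elaplace nu l)%E.
Proof.
rewrite /elaplace ge0_integral_distribution; [|exact: measurable_expRN|]; last first.
  by move=> x; rewrite lee_fin expR_ge0.
rewrite fubini_tonelli1; last 2 first.
- apply: (measurableT_comp (measurable_expRN l)).
  exact: (measurable_funPT (@Defs.add_pair R)).
- by move=> x; rewrite /= lee_fin expR_ge0.
rewrite -ge0_integralZr//; last 2 first.
- exact: measurable_expRN.
- by apply: integral_ge0 => x _; rewrite lee_fin expR_ge0.
apply: eq_integral => x _; rewrite -ge0_integralZl_EFin//; last first.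
  exact: measurable_expRN.
apply: eq_integral => y _ /=.
by rewrite /Defs.add_pair/= mulrDr opprD expRD EFinM.
Qed.

Lemma supported_convolution (A B C : set RT) mu nu :
  measurable A -> measurable B -> measurable C ->
  supported_on A mu -> supported_on B nu ->
  (forall x y : R, A x -> B y -> C (x + y)) -> supported_on C (convolution mu nu).
Proof.
move=> mA mB mC sA sB ABC; apply/eqP; rewrite eq_le probability_le1//=.
have -> : 1%E = (mu \x nu)%E (A `*` B).
  by rewrite product_measure1E// [X in (X * _)%E]sA [X in (_ * X)%E]sB mule1.
rewrite /convolution/= /distribution /pushforward; apply: le_measure.
- by apply: mem_set; exact: measurableX.
- by apply: mem_set; rewrite -[X in measurable X]setTI; exact: (measurable_funPT (@Defs.add_pair R)).
- by move=> [x y] [/= Ax By]; exact: ABC.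
Qed.

Lemma supported_dirac (A : set RT) (a : R) : measurable A -> A a ->
  supported_on A (dirac (a : RT) : law R).
Proof. by move=> mA Aa; rewrite /supported_on/= diracE mem_set. Qed.

Lemma supported_convolution_upto (p : nat -> law R) k :
  (forall m, (0 < m)%N -> supported_on `[0, +oo[ (p m)) ->
  supported_on `[0, +oo[ (convolution_upto p k).
Proof.
move=> sp; elim: k => [|k IH] /=.
  by apply: supported_dirac => //=; rewrite in_itv/= lexx.
apply: (@supported_convolution `[0, +oo[%classic `[0, +oo[%classic) => //.
  exact: sp.
by move=> x y /=; rewrite !in_itv/= !andbT; exact: addr_ge0.
Qed.

Lemma laplace_convolution mu nu l : supported_on `[0, +oo[ mu -> supported_on `[0, +oo[ nu ->
  0 <= l -> laplace (convolution mu nu) l = laplace mu l * laplace nu l.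
Proof.
move=> smu snu l0; apply: EFin_inj; rewrite EFinM -!elaplaceE//.
  exact: elaplace_convolution.
apply: (@supported_convolution `[0, +oo[%classic `[0, +oo[%classic) => //.
by move=> x y /=; rewrite !in_itv/= !andbT; exact: addr_ge0.
Qed.

Lemma laplace_dirac (a l : R) : 0 <= a -> 0 <= l ->
  laplace (dirac (a : RT) : law R) l = expR (- (l * a)).
Proof.
move=> a0 l0; apply: EFin_inj; rewrite -elaplaceE//; last first.
  by apply: supported_dirac => //=; rewrite in_itv/= a0.
rewrite /elaplace integral_dirac//; last exact: measurable_expRN.
by rewrite diracT mul1e.
Qed.

Lemma laplace_convolution_pow mu k l : supported_on `[0, +oo[ mu -> 0 <= l ->
  laplace (convolution_upto (fun=> mu) k) l = laplace mu l ^+ k.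
Proof.
move=> smu l0; elim: k => [|k IH] /=.
  by rewrite laplace_dirac// mulr0 oppr0 expR0 expr0.
rewrite laplace_convolution// ?IH ?exprSr//.
exact: supported_convolution_upto.
Qed.

End convolution_laplace.

Section countable_mixture.
Context (R : realType).
Local Notation RT := (measurableTypeR R).

Lemma integral_countable_mixture (rho : law R) (c : nat -> R) (m : nat -> law R) :
  (forall k, 0 <= c k) ->
  (forall A : set RT, measurable A -> rho A = \sum_(k <oo) (c k)%:E * m k A)%E ->
  forall f : RT -> \bar R, measurable_fun setT f -> (forall x, 0 <= f x)%E ->
  (\int[rho]_x f x = \sum_(k <oo) (c k)%:E * \int[m k]_x f x)%E.
Proof.
move=> c0 rhoE f mf f0.
pose s := mseries (fun k => mscale (NngNum (c0 k)) (m k)) 0.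
rewrite (@eq_measure_integral _ _ _ _ s)//; last by move=> A mA _; exact: (rhoE A mA).
rewrite ge0_integral_measure_series//.
by apply: eq_eseriesr => k _; rewrite ge0_integral_mscale.
Qed.

Lemma geometric_law_mixture (a : R) (a01 : 0 < a < 1) (p : nat -> law R) :
  forall A : set RT, measurable A -> (geometric_law a01 p A =
    \sum_(k <oo) ((1 - a) * a ^+ k)%:E * convolution_upto p k A)%E.
Proof.
move=> A mA; have [a0 a1] := andP a01.
rewrite [LHS]geometric_mixtureE.
have -> : \d_(0 : RT) A = ((a ^+ 0)%:E * convolution_upto p 0 A)%E.
  by rewrite expr0 mul1e.
rewrite -(@nneseries_recl _ xpredT (fun k => (a ^+ k)%:E * convolution_upto p k A)%E)//.
  rewrite -nneseriesZl; last first.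
    by move=> k _; rewrite mule_ge0// lee_fin exprn_ge0// ltW.
  by apply: eq_eseriesr => k _; rewrite muleA EFinM.
by move=> k _; rewrite mule_ge0// lee_fin exprn_ge0// ltW.
Qed.

Lemma geometric_eseries (x : R) : 0 <= x < 1 ->
  (\sum_(k <oo) (x ^+ k)%:E = ((1 - x)^-1)%:E)%E.
Proof.
move=> /andP[x0 x1].
have x1' : `|x| < 1 by rewrite ger0_norm.
have cv : series (geometric 1 x) @ \oo --> ((1 - x)^-1 : R).
  by have := @cvg_geometric_series R 1 x x1'; rewrite mul1r.
rewrite -(cvg_lim _ cv)// -EFin_lim; last by apply/cvg_ex; exists (1 - x)^-1.
congr (limn _); apply/funext => n /=.
by rewrite seriesEnat sumEFin; congr (_%:E); apply: eq_bigr => k _; rewrite /= mul1r.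
Qed.

(** Geometric series.  The shift s is 0 for the geometric law of a row and 1 for a
    geometric sum, which has at least one term. *)
Lemma laplace_geometric_mixture (rho : law R) (mu : law R) (a : R) (s : nat) (l : R) :
  0 < a < 1 -> 0 <= l ->
  supported_on `[0, +oo[ mu ->
  (forall A : set RT, measurable A -> rho A =
     \sum_(k <oo) ((1 - a) * a ^+ k)%:E * convolution_upto (fun=> mu) (k + s) A)%E ->
  elaplace rho l = ((1 - a) * laplace mu l ^+ s / (1 - a * laplace mu l))%:E.
Proof.
move=> /andP[a0 a1] l0 smu rhoE.
have L0 := laplace_gt0 smu l0; have L1 := laplace_le1 smu l0.
have c0 k : 0 <= (1 - a) * a ^+ k by rewrite mulr_ge0 ?subr_ge0 ?exprn_ge0// ltW.
rewrite /elaplace (integral_countable_mixture c0 rhoE); last 2 first.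
- exact: measurable_expRN.
- by move=> x; rewrite lee_fin expR_ge0.
have E k : (((1 - a) * a ^+ k)%:E * elaplace (convolution_upto (fun=> mu) (k + s)) l =
    ((1 - a) * laplace mu l ^+ s)%:E * ((a * laplace mu l) ^+ k)%:E)%E.
  rewrite elaplaceE//; last exact: supported_convolution_upto.
  rewrite laplace_convolution_pow// -!EFinM; congr (_%:E).
  by rewrite exprD exprMn; ring.
rewrite (eq_eseriesr (fun k _ => E k)) nneseriesZl; last first.
  by move=> k _; rewrite lee_fin exprn_ge0// mulr_ge0// ltW.
rewrite geometric_eseries ?EFinM//.
by rewrite mulr_ge0 ?(ltW a0) ?(ltW L0)//= (le_lt_trans _ a1)// ler_piMr// ltW.
Qed.

End countable_mixture.

(** * Sums of a random number of independent variables *)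

Section rectangles.
Context d1 d2 (T1 : measurableType d1) (T2 : measurableType d2) (R : realType).

Lemma eq_measure_rectangles (m1 m2 : {measure set (T1 * T2) -> \bar R}) :
  (m1 setT < +oo)%E ->
  (forall A B, measurable A -> measurable B -> m1 (A `*` B) = m2 (A `*` B)) ->
  forall D, measurable D -> m1 D = m2 D.
Proof.
move=> m1oo m12 D mD.
pose C : set (set (T1 * T2)) := [set A `*` B | A in measurable & B in measurable].
apply: (@measure_unique _ R _ C (fun=> setT)) => //.
- by rewrite measurable_prod_measurableType.
- move=> _ _ [A1 mA1 [A2 mA2 <-]] [B1 mB1 [B2 mB2 <-]].
  rewrite -setXI; exists (A1 `&` B1); first exact: measurableI.
  by exists (A2 `&` B2) => //; exact: measurableI.
- by move=> _; exists setT => //; exists setT => //; exact: setXTT.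
- by rewrite -subTset => x _; exists 0%N.
- by move=> _ [A mA [B mB <-]]; exact: m12.
Qed.

End rectangles.

Section random_sum.
Context (R : realType) (d : measure_display) (Omega : measurableType d)
  (P : probability Omega R).
Local Notation RT := (measurableTypeR R).
Variable X : nat -> {RV P >-> RT}.
Hypotheses (indepX : mutually_independent X) (identX : identically_distributed X).

Definition partial_sum (k : nat) (w : Omega) : RT := \sum_(i < k) (X i w : R).

Lemma measurable_partial_sum k : measurable_fun setT (partial_sum k).
Proof. by apply: measurable_sum => i; exact: (measurable_funPT (X i)). Qed.

Local Notation mu := (distribution P (X 0%N) : law R).

(** Carrying an event on later variables through the induction is what gives the
    product form of the joint law of [partial_sum k] and [X k] restricted to that
    event; adding the two coordinates then produces one more convolution. *)
Lemma partial_sum_indep (k : nat) (J : {fset nat}) (B : nat -> set RT) (A : set RT) :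
  (forall j, j \in J -> (k <= j)%N) -> (forall j, measurable (B j)) -> measurable A ->
  P (partial_sum k @^-1` A `&` \bigcap_(j in [set` J]) (X j @^-1` B j)) =
  (convolution_upto (fun=> mu) k A * P (\bigcap_(j in [set` J]) (X j @^-1` B j)))%E.
Proof.
elim: k J B A => [|k IH] J B A kJ mB mA.
  have S0 w : partial_sum 0 w = 0 by rewrite /partial_sum big_ord0.
  rewrite /= diracE; have [A0|A0] := boolP ((0 : RT) \in A).
    rewrite mul1e; congr (P _); rewrite (_ : _ @^-1` _ = setT) ?setTI//.
    by rewrite -subTset => w _ /=; rewrite S0; exact: set_mem.
  rewrite mul0e (_ : _ @^-1` _ = set0) ?set0I ?measure0//.
  by rewrite -subset0 => w /=; rewrite S0 => /mem_set; rewrite (negbTE A0).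
set E := \bigcap_(j in _) _.
have mE : measurable E.
  apply: fin_bigcap_measurable => // j _.
  by rewrite -[X in measurable X]setTI; exact: (measurable_funPT (X j)).
have mP : measurable_fun setT (fun w => (partial_sum k w, X k w : RT)).
  by apply: measurable_fun_pair => //; exact: measurable_partial_sum.
pose c : {nonneg R} := NngNum (fine_ge0 (measure_ge0 P E)).
pose h : {mfun Omega >-> (RT * RT)%type} := mfun_Sub (mem_set mP).
have cE : c%:num%:E = P E by rewrite /= fineK// fin_num_measure.
have HE : forall D, measurable D -> pushforward (mrestr P mE) h D =
    mscale c (convolution_upto (fun=> mu) k \x mu)%E D.
  apply: eq_measure_rectangles.
    rewrite /= /pushforward /mrestr (le_lt_trans (probability_le1 _ _)) ?ltry//.
    by rewrite preimage_setT setTI.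
  move=> A1 B1 mA1 mB1.
  have kJ' j : j \in (k |` J)%fset -> (k <= j)%N.
    by rewrite in_fset1U => /orP[/eqP ->//|/kJ/ltnW].
  have mB' j : measurable (if j == k then B1 else B j) by case: ifP.
  have kNJ : k \notin J by apply/negP => /kJ; rewrite ltnn.
  have := IH (k |` J)%fset _ A1 kJ' mB' mA1.
  have -> : \bigcap_(j in [set` (k |` J)%fset]) (X j @^-1` (if j == k then B1 else B j))
      = X k @^-1` B1 `&` E.
    rewrite bigcap_fsetU1 eqxx; congr (_ `&` _); apply: eq_bigcapr => j /= jJ.
    by case: eqP => // jk; rewrite jk (negbTE kNJ) in jJ.
  move=> H.
  suff : P (partial_sum k @^-1` A1 `&` (X k @^-1` B1 `&` E)) =
      (P E * (convolution_upto (fun=> mu) k A1 * mu B1))%E.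
    rewrite setIA => PE; apply: (etrans PE); rewrite -cE; congr (_ * _)%E.
    by apply/esym; exact: product_measure1E.
  rewrite H muleCA; congr (_ * _)%E.
  have := indepX (k |` J)%fset mB'.
  have -> : \bigcap_(j in [set` (k |` J)%fset]) (X j @^-1` (if j == k then B1 else B j))
      = X k @^-1` B1 `&` E.
    rewrite bigcap_fsetU1 eqxx; congr (_ `&` _); apply: eq_bigcapr => j /= jJ.
    by case: eqP => // jk; rewrite jk (negbTE kNJ) in jJ.
  rewrite big_fsetU1//= eqxx => ->.
  rewrite muleC; congr (_ * _)%E; last exact: (identX k 0%N mB1).
  rewrite (indepX J mB) big_seq [RHS]big_seq; apply: eq_bigr => j jJ.
  by case: eqP => // jk; rewrite jk (negbTE kNJ) in jJ.
have mD : measurable (@Defs.add_pair R @^-1` A).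
  by rewrite -[X in measurable X]setTI; exact: (measurable_funPT (@Defs.add_pair R)).
have := HE _ mD; rewrite /mscale/= cE muleC => <-.
rewrite /pushforward /mrestr; congr (P (_ `&` _)).
by apply/seteqP; split => w /=; rewrite /partial_sum big_ord_recr.
Qed.

Lemma distribution_partial_sum (k : nat) (A : set RT) : measurable A ->
  P (partial_sum k @^-1` A) = convolution_upto (fun=> mu) k A.
Proof.
move=> mA; have := @partial_sum_indep k fset0 (fun=> setT) A.
have -> : [set` fset0] = set0 :> set nat by apply/seteqP; split.
rewrite bigcap_set0 setIT probability_setT mule1; exact.
Qed.

Lemma sigma_of_partial_sum k A : measurable A -> sigma_of X (partial_sum k @^-1` A).
Proof.
pose GT := g_sigma_algebraType (\bigcup_i preimage_set_system setT (X i) measurable).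
have mX i : measurable_fun [set: GT] (X i : GT -> RT).
  move=> _ B mB; apply: sub_sigma_algebra; exists i => //; exists B => //.
have mS : measurable_fun [set: GT] (partial_sum k : GT -> RT).
  by apply: measurable_sum => i; exact: mX.
by move=> mA; have := mS measurableT A mA; rewrite setTI.
Qed.

Variables (p : R) (G : {RV P >-> nat}).
Hypotheses (p01 : 0 < p < 1) (geomG : geometric_variable p G)
  (indepG : independent_of_sequence G X).

(** The masses prescribed at the positive integers already add up to 1. *)
Lemma geometric_variable_neq0 : P (G @^-1` [set 0%N]) = 0%E.
Proof.
have [p0 p1] := andP p01.
have mG k : measurable (G @^-1` [set k]).
  by rewrite -[X in measurable X]setTI; exact: (measurable_funPT G).
have : P setT = (\sum_(k <oo) P (G @^-1` [set k]))%E.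
  rewrite -measure_semi_bigcup//.
  - by congr (P _); apply/seteqP; split => w // _; exists (G w).
  - by move=> i j _ _ [w [/= -> ->]].
  - exact: bigcupT_measurable.
rewrite nneseries_recl// -nneseries_addn//.
under eq_eseriesr do rewrite addn1 geomG//= EFinM.
rewrite nneseriesZl; last by move=> k _; rewrite lee_fin exprn_ge0// subr_ge0 ltW.
rewrite geometric_eseries; last by rewrite subr_ge0 (ltW p1)/= gtrBl.
rewrite probability_setT subKr -EFinM divff ?gt_eqF//.
rewrite -(fineK (fin_num_measure P _ (mG 0%N))) -EFinD => -[/esym/eqP].
by rewrite -subr_eq0 addrK => /eqP ->.
Qed.

(** Split according to the value of G, which is independent of the sums.  The weight
    p is written 1 - (1 - p) to match [laplace_geometric_mixture] with a = 1 - p. *)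
Theorem random_sum_law (A : set RT) : measurable A ->
  (P [set w | A (\sum_(i < G w) (X i w : R))%R] =
   \sum_(k <oo) ((1 - (1 - p)) * (1 - p) ^+ k)%:E * convolution_upto (fun=> mu) (k + 1) A)%E.
Proof.
move=> mA.
have mG k : measurable (G @^-1` [set k]).
  by rewrite -[X in measurable X]setTI; exact: (measurable_funPT G).
have mS k : measurable (partial_sum k @^-1` A).
  by rewrite -[X in measurable X]setTI; exact: measurable_partial_sum.
have mGS k : measurable (G @^-1` [set k] `&` partial_sum k @^-1` A).
  exact: measurableI.
transitivity (\sum_(k <oo) P (G @^-1` [set k] `&` partial_sum k @^-1` A))%E.
  rewrite -measure_semi_bigcup//.
  - congr (P _); apply/seteqP; split => w /=; first by move=> Aw; exists (G w).
    by move=> [k _ [/= ->]].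
  - by move=> i j _ _ [w [[/= -> _] [-> _]]].
  - exact: bigcupT_measurable.
rewrite nneseries_recl// -nneseries_addn//.
rewrite indepG; last exact: sigma_of_partial_sum.
rewrite geometric_variable_neq0 mul0e add0e; apply: eq_eseriesr => k _.
rewrite indepG; last exact: sigma_of_partial_sum.
by rewrite addn1 geomG//= distribution_partial_sum// subKr.
Qed.

End random_sum.

(** * Geometrically infinitely divisible laws are geometric limits *)

Section converse.
Context (R : realType).
Local Notation RT := (measurableTypeR R).

(** Under P the event G = 1 has positive probability, so a summand charging the
    negative half-line would make rho charge it. *)
Lemma gid_decomposition (rho : law R) (p : R) : 0 < p < 1 ->
  supported_on `[0, +oo[ rho -> geometrically_infinitely_divisible rho ->
  exists2 mu : law R, supported_on `[0, +oo[ mu &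
    forall A : set RT, measurable A -> (rho A =
     \sum_(k <oo) ((1 - (1 - p)) * (1 - p) ^+ k)%:E *
        convolution_upto (fun=> mu) (k + 1) A)%E.
Proof.
move=> p01 srho gid; have [d [Om [P [X [G [iX dX gG iG rhoE] ] ] ] ] ] := gid p p01.
have [p0 p1] := andP p01.
have rhoS (A : set RT) : measurable A -> (rho A =
     \sum_(k <oo) ((1 - (1 - p)) * (1 - p) ^+ k)%:E *
        convolution_upto (fun=> distribution P (X 0%N)) (k + 1) A)%E.
  by move=> mA; rewrite rhoE// (random_sum_law iX dX p01 gG iG).
exists (distribution P (X 0%N)) => //.
have mN : measurable (~` `[0, +oo[%classic : set RT) by exact: measurableC.
have := rhoS _ mN; rewrite supported_setC// => /esym/eqP.
have c0 k : (0 <= ((1 - (1 - p)) * (1 - p) ^+ k)%:E)%E.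
  by rewrite lee_fin mulr_ge0 ?subKr ?exprn_ge0 ?subr_ge0// ltW.
rewrite nneseries_recl//; last by move=> k _; exact: mule_ge0.
rewrite padde_eq0; [|exact: mule_ge0|]; last first.
  by apply: nneseries_ge0 => k _ _; exact: mule_ge0.
move=> /andP[/eqP + _]; rewrite expr0 mulr1 subKr add0n -(distribution_partial_sum iX dX)//.
move=> /eqP; rewrite mule_eq0 eqe gt_eqF//= => /eqP P0.
apply: setC_supported => //; rewrite -P0 /distribution /pushforward; congr (P _).
by apply/seteqP; split => w /=; rewrite /partial_sum big_ord_recl big_ord0 addr0.
Qed.

Lemma laplace_gid_part (rho mu : law R) (p l : R) : 0 < p < 1 -> 0 <= l ->
  supported_on `[0, +oo[ rho -> supported_on `[0, +oo[ mu ->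
  (forall A : set RT, measurable A -> (rho A =
     \sum_(k <oo) ((1 - (1 - p)) * (1 - p) ^+ k)%:E *
        convolution_upto (fun=> mu) (k + 1) A)%E) ->
  laplace mu l = laplace rho l / (p + (1 - p) * laplace rho l).
Proof.
move=> /andP[p0 p1] l0 srho smu rhoE.
have q01 : 0 < 1 - p < 1 by rewrite subr_gt0 p1 gtrBl.
have := laplace_geometric_mixture q01 l0 smu rhoE; rewrite elaplaceE// => -[->].
have L0 := laplace_gt0 smu l0; have L1 := laplace_le1 smu l0.
set L := laplace mu l in L0 L1 *.
have D0 : 0 < 1 - (1 - p) * L by nra.
rewrite expr1 subKr; field.
rewrite gt_eqF//= gt_eqF//.
have -> : p * (1 - (1 - p) * L) + (1 - p) * (p * L) = p by ring.
exact: p0.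
Qed.

(** Markov inequality for 1 - exp(-x), which is at least 1 - exp(-delta) beyond delta. *)
Lemma laplace_markov (mu : law R) (delta : R) : 0 < delta ->
  supported_on `[0, +oo[ mu ->
  (mu `[delta, +oo[%classic <= ((1 - laplace mu 1) / (1 - expR (- delta)))%:E)%E.
Proof.
move=> d0 smu.
have e1 : 0 < 1 - expR (- delta) by rewrite subr_gt0 expR_lt1 oppr_lt0.
have md : measurable (`[delta, +oo[%classic : set RT) by [].
have ji : mu.-integrable [set: RT] (EFin \o (\1_(`[delta, +oo[%classic : set RT) : RT -> R)).
  apply: (@integrable_bounded _ _ _ 1) => //.
  by move=> x; rewrite indicE; case: (_ \in _); rewrite ?normr1 ?normr0.
have -> : mu `[delta, +oo[%classic = (\int[mu]_x \1_(`[delta, +oo[%classic : set RT) x)%:E.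
  by rewrite /Rintegral integral_indic// setIT fineK// fin_num_measure.
rewrite lee_fin ler_pdivlMr// mulrC -RintegralZl// laplaceE//.
rewrite -[X in _ <= X - _](prob_mean_cst mu) -RintegralB//; last 2 first.
- by apply: (@integrable_bounded _ _ (cst 1) 1) => // x; rewrite normr1.
- exact: integrable_expm.
apply: le_Rintegral => //.
- by have := integrableZl measurableT (1 - expR (- delta)) ji; apply: eq_integrable.
- have j1 : mu.-integrable [set: RT] (EFin \o cst (1 : R)).
    by apply: (@integrable_bounded _ _ (cst 1) 1) => // x; rewrite normr1.
  have := integrableB measurableT j1 (integrable_expm mu (@ler01 R)).
  by apply: eq_integrable.
- move=> x _; rewrite indicE; have [xd|xd] := boolP (x \in _).
    rewrite mulr1 lerB// ler_expR mul1r lerN2 le_max.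
    by move: xd => /set_mem; rewrite /= in_itv/= andbT => ->.
  by rewrite mulr0 subr_ge0 expm_le1.
Qed.

Lemma laplace_geometric_law (a : R) (a01 : 0 < a < 1) (mu : law R) l : 0 <= l ->
  supported_on `[0, +oo[ mu ->
  elaplace (geometric_law a01 (fun=> mu)) l = ((1 - a) / (1 - a * laplace mu l))%:E.
Proof.
move=> l0 smu; rewrite (@laplace_geometric_mixture _ _ mu a 0)// ?expr0 ?mulr1//.
by move=> A mA; rewrite geometric_law_mixture//; apply: eq_eseriesr => k _; rewrite addn0.
Qed.

Lemma supported_geometric_law (a : R) (a01 : 0 < a < 1) (p : nat -> law R) :
  (forall m, (0 < m)%N -> supported_on `[0, +oo[ (p m)) ->
  supported_on `[0, +oo[ (geometric_law a01 p).
Proof.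
move=> sp.
have mN : measurable (~` `[0, +oo[%classic : set RT) by exact: measurableC.
apply: setC_supported => //; rewrite geometric_law_mixture// eseries0// => k _ _.
by rewrite supported_setC ?mule0//; exact: supported_convolution_upto.
Qed.

Theorem gid_is_geometric_limit (a : nat -> R) (a01 : forall n, 0 < a n < 1) (rho : law R) :
  a n @[n --> \oo] --> (1 : R) ->
  supported_on `[0, +oo[%classic rho -> geometrically_infinitely_divisible rho ->
  exists pi_ : nat -> nat -> law R,
    [/\ row_constant pi_,
        forall n m : nat, (0 < m)%N -> supported_on `]0, +oo[%classic (pi_ n m),
        locally_infinitesimal a pi_
      & weak_cvg (fun n => geometric_law (a01 n) (pi_ n)) rho].
Proof.
move=> a1 srho gid.
have p01 n : 0 < 1 - a n < 1.
  by have /andP[? ?] := a01 n; rewrite subr_gt0 gtrBl; apply/andP.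
have /choice [mu mu_] n : exists mu : law R, supported_on `[0, +oo[ mu /\
    forall l, 0 <= l ->
      laplace mu l = laplace rho l / ((1 - a n) + a n * laplace rho l).
  have [mu smu rhoE] := gid_decomposition (p01 n) srho gid.
  exists mu; split => // l l0.
  by rewrite (laplace_gid_part (p01 n) l0 srho smu rhoE) subKr.
(* the number of summands is of order 1 / (1 - a n), so the total shift vanishes *)
pose eps n := (1 - a n) ^+ 2.
have eps0 n : 0 < eps n by rewrite exprn_gt0//; case/andP: (p01 n).
pose nu n := convolution (mu n) (dirac (eps n : RT) : law R).
have snu n : supported_on `]0, +oo[%classic (nu n).
  apply: (@supported_convolution _ `[0, +oo[%classic `]0, +oo[%classic) => //.
  - by case: (mu_ n).
  - by apply: supported_dirac => //=; rewrite in_itv/= eps0.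
  - by move=> x y /=; rewrite !in_itv/= !andbT; exact: ltr_wpDl.
have snu' n : supported_on `[0, +oo[%classic (nu n).
  apply: supported_subset (snu n) => // x /=; rewrite !in_itv/= !andbT; exact: ltW.
have Lnu n l : 0 <= l -> laplace (nu n) l =
    laplace rho l / ((1 - a n) + a n * laplace rho l) * expR (- (l * eps n)).
  move=> l0; have [smu Lmu] := mu_ n.
  rewrite laplace_convolution// ?Lmu// ?laplace_dirac//; first exact: ltW.
  by apply: supported_dirac => //=; rewrite in_itv/= ltW.
have cp : 1 - a n @[n --> \oo] --> (0 : R).
  by rewrite -(subrr 1); apply: cvgB => //; exact: cvg_cst.
have cD l : (1 - a n) + a n * laplace rho l @[n --> \oo] --> laplace rho l.
  rewrite -[X in _ --> X]add0r -[X in _ --> _ + X]mul1r.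
  by apply: cvgD => //; apply: cvgMl.
have ce l : expR (- (l * eps n)) @[n --> \oo] --> (1 : R).
  rewrite -expR0; apply: continuous_cvg; first exact: continuous_expR.
  rewrite -oppr0; apply: cvgN; rewrite -(mulr0 l); apply: cvgMr.
  by rewrite -[X in _ --> X](mulr0 0); exact: (cvgM cp cp).
have cL l : 0 <= l -> laplace (nu n) l @[n --> \oo] --> (1 : R).
  move=> l0; rewrite (funext (fun n => Lnu n l l0)).
  rewrite -[X in _ --> X]mulr1; apply: cvgM => //.
  rewrite -[X in _ --> X](@divff _ (laplace rho l)) ?gt_eqF ?laplace_gt0//.
  apply: cvgM; first exact: cvg_cst.
  by apply: cvgV => //; rewrite gt_eqF ?laplace_gt0.
exists (fun n _ => nu n); split.
- by exists nu.
- by move=> n m _; exact: snu.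
- move=> tau delta tau0 delta0.
  pose u n : \bar R := ((1 - laplace (nu n) 1) / (1 - expR (- delta)))%:E.
  apply: (@squeeze_cvge _ _ _ _ (cst 0%E) _ u).
  + apply: nearW => n; apply/andP; split.
      apply: (@le_trans _ _ (nu n `[delta, +oo[%classic)); first exact: measure_ge0.
      apply: ereal_sup_ubound; exists 1%N => //=.
      rewrite /steps absz_gt0 gt_eqF// ceil_gt0 mulr_gt0// invr_gt0.
      by case/andP: (p01 n).
    by apply: ge_ereal_sup => _ [m _ <-]; exact: laplace_markov.
  + exact: cvg_cst.
  + apply: cvg_EFin; first exact: nearW.
    rewrite -(mul0r (1 - expR (- delta))^-1); apply: cvgMl.
    by rewrite -(subrr 1); apply: cvgB; [exact: cvg_cst|exact: cL].
- apply: laplace_cvg_weak_cvg => //.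
    by move=> n; exact: supported_geometric_law.
  move=> k; set l := k%:R; have l0 : 0 <= l by rewrite /l.
  have r0 := laplace_gt0 srho l0.
  pose q n := (1 - expR (- (l * eps n))) / (1 - a n).
  have E n : laplace (geometric_law (a01 n) (fun=> nu n)) l =
      ((1 - a n) + a n * laplace rho l) / (1 + a n * laplace rho l * q n).
    apply: EFin_inj; rewrite -elaplaceE//; last exact: supported_geometric_law.
    rewrite laplace_geometric_law// Lnu//; congr (_%:E); rewrite /q.
    have /andP[a0 a1'] := a01 n.
    have e1 : expR (- (l * eps n)) <= 1.
      by rewrite -expR0 ler_expR oppr_le0 mulr_ge0// ltW.
    have p0 : 0 < 1 - a n by rewrite subr_gt0.
    have ar : 0 < a n * laplace rho l by rewrite mulr_gt0.
    have t0 : 0 <= a n * laplace rho l * (1 - expR (- (l * eps n))).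
      by rewrite mulr_ge0 ?subr_ge0// ltW.
    set e := expR _ in e1 t0 *; set r := laplace rho l in r0 ar t0 *.
    field; rewrite !gt_eqF//; try lra.
  rewrite (funext E).
  have cq : q n @[n --> \oo] --> (0 : R).
    have cl : l * (1 - a n) @[n --> \oo] --> (0 : R).
      by rewrite -(mulr0 l); apply: cvgMr.
    apply: squeeze_cvgr cl; last exact: cvg_cst.
    apply: nearW => n; have /andP[p0 _] := p01 n.
    have e1 : expR (- (l * eps n)) <= 1.
      by rewrite -expR0 ler_expR oppr_le0 mulr_ge0// ltW.
    apply/andP; split; first by apply: divr_ge0; [rewrite subr_ge0|exact: ltW].
    rewrite /q ler_pdivrMr// -mulrA -expr2.
    by rewrite lerBlDr -lerBlDl expR_ge1Dx.
  rewrite -[X in _ --> X]divr1; apply: cvgM; first exact: cD.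
  apply: cvgV; first exact: oner_neq0.
  rewrite -[X in _ --> X]addr0; apply: cvgD; first exact: cvg_cst.
  rewrite -[X in _ --> X](mulr0 (1 * laplace rho l)); apply: cvgM => //.
  exact: cvgMl.
Qed.

End converse.

(** * Splitting the digits of a uniform variable *)

Section uniform_measure.
Context (R : realType).
Local Notation RT := (measurableTypeR R).

Lemma measurable_01 : measurable (`[0, 1] : set RT).
Proof. by []. Qed.

Definition unif01 := mrestr (@lebesgue_measure R) measurable_01.

HB.instance Definition _ := Measure.on unif01.

Let unif01_setT : unif01 setT = 1%E.
Proof.
by rewrite /unif01 /mrestr setTI lebesgue_measure_itv/= lte01 oppr0 adde0.
Qed.

HB.instance Definition _ := Measure_isProbability.Build _ _ _ unif01 unif01_setT.

Local Notation P := (unif01 : law R).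

(** The tail of the uniform law on [0, 1]. *)
Definition surv (s : R) : R := Num.max 0 (Num.min 1 (1 - s)).

Lemma surv_le0 s : s <= 0 -> surv s = 1.
Proof. by move=> s0; rewrite /surv min_l ?lerBrDl ?gerDr// max_r. Qed.

Lemma surv_ge1 s : 1 <= s -> surv s = 0.
Proof. by move=> s1; rewrite /surv max_l// ge_min subr_le0 s1 orbT. Qed.

Lemma surv_mid s : 0 <= s <= 1 -> surv s = 1 - s.
Proof.
by move=> /andP[s0 s1]; rewrite /surv min_r ?gerBl// max_r// subr_ge0.
Qed.

Lemma surv_half s : surv s = 2^-1 * surv (2 * s) + 2^-1 * surv (2 * s - 1).
Proof.
have [s0|s0] := leP s 0.
  by rewrite !surv_le0//; lra.
have [s1|s1] := leP 1 s.
  by rewrite !surv_ge1//; lra.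
have [sh|sh] := leP s 2^-1.
  by rewrite (@surv_le0 (2 * s - 1)) ?surv_mid; lra.
by rewrite (@surv_ge1 (2 * s)) ?surv_mid; lra.
Qed.



Lemma unif01_ray s : P `]s, +oo[%classic = (surv s)%:E.
Proof.
rewrite /= /unif01 /mrestr.
have [s0|s0] := ltP s 0.
  rewrite surv_le0 ?(ltW s0)// setIidr.
    by rewrite lebesgue_measure_itv/= lte01 oppr0 adde0.
  by move=> x /=; rewrite !in_itv/= andbT => /andP[x0 _]; exact: lt_le_trans x0.
have -> : `]s, +oo[%classic `&` `[0, 1]%classic = `]s, 1]%classic :> set R.
  apply/seteqP; split => x /=; rewrite !in_itv/= ?andbT.
    by move=> [-> /andP[]].
  by move=> /andP[sx ->]; rewrite sx (le_trans s0 (ltW sx)).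
rewrite lebesgue_measure_itv/= lte_fin; have [s1|s1] := ltP s 1.
  by rewrite surv_mid ?s0 ?ltW// EFinD.
by rewrite surv_ge1.
Qed.

Definition bit (x : R) : bool := 2^-1 <= x.
(** Shift of the binary expansion on [0, 1[: x is half of bit x + doubling x. *)
Definition doubling (x : R) : R := if bit x then 2 * x - 1 else 2 * x.

Lemma measurable_bit : measurable_fun [set: RT] (bit : RT -> bool).
Proof. exact: measurable_fun_ler. Qed.

Lemma measurable_doubling : measurable_fun [set: RT] (doubling : RT -> RT).
Proof.
apply: measurable_fun_if => //; first exact: measurable_bit.
by apply: measurable_funB => //; exact: measurable_funM.
Qed.

Lemma unif01_bit_ray (c : bool) (s : R) :
  P ([set x | bit x = c] `&` doubling @^-1` `]s, +oo[%classic) =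
  ((2^-1)%:E * (surv s)%:E)%E.
Proof.
rewrite /= /unif01 /mrestr; case: c.
- have -> : [set x | bit x = true] `&` doubling @^-1` `]s, +oo[%classic `&` `[0, 1]%classic
      = (if s < 0 then `[2^-1, 1]%classic else `]((s + 1) / 2), 1]%classic) :> set R.
    apply/seteqP; split => x; rewrite /= /doubling /bit.
      move=> [[bx]]; rewrite bx !in_itv/= andbT => sx /andP[x0 x1].
      by case: ltP => s0 /=; rewrite in_itv/= ?bx ?x1//; apply/andP; split => //; lra.
    case: ltP => s0 /=; rewrite !in_itv/= => /andP[hx x1].
      by rewrite hx andbT x1; split; [split => //; lra|lra].
    have bx : 2^-1 <= x by lra.
    by rewrite bx andbT x1; split; [split => //; lra|lra].
  case: ltP => s0; rewrite lebesgue_measure_itv/= lte_fin.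
    rewrite surv_le0 ?(ltW s0)// ifT; last lra.
    by rewrite -?EFinN -?EFinD -EFinM; congr (_%:E); lra.
  have [s1|s1] := ltP s 1.
    rewrite surv_mid ?s0 ?ltW// ifT; last lra.
    by rewrite -?EFinN -?EFinD -EFinM; congr (_%:E); lra.
  by rewrite surv_ge1// ifF ?mule0//; apply/negbTE; rewrite -leNgt; lra.
- have -> : [set x | bit x = false] `&` doubling @^-1` `]s, +oo[%classic `&` `[0, 1]%classic
      = (if s < 0 then `[0, 2^-1[%classic else `](s / 2), 2^-1[%classic) :> set R.
    apply/seteqP; split => x; rewrite /= /doubling /bit.
      move=> [[bx]]; rewrite bx !in_itv/= andbT => sx /andP[x0 x1].
      move/negbT: bx; rewrite -ltNge => bx.
      by case: ltP => s0 /=; rewrite in_itv/= ?bx ?x0//= andbT; lra.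
    case: ltP => s0 /=; rewrite !in_itv/= => /andP[x0 hx].
      have bx : (2^-1 <= x) = false by apply/negbTE; rewrite -ltNge.
      by rewrite bx andbT; split; [split => //; lra|lra].
    have bx : (2^-1 <= x) = false by apply/negbTE; rewrite -ltNge.
    by rewrite bx andbT; split; [split => //; lra|lra].
  case: ltP => s0; rewrite lebesgue_measure_itv/= lte_fin.
    rewrite surv_le0 ?(ltW s0)// ifT; last lra.
    by rewrite -?EFinN -?EFinD -EFinM; congr (_%:E); lra.
  have [s1|s1] := ltP s 1.
    rewrite surv_mid ?s0 ?ltW// ifT; last lra.
    by rewrite -?EFinN -?EFinD -EFinM; congr (_%:E); lra.
  by rewrite surv_ge1// ifF ?mule0//; apply/negbTE; rewrite -leNgt; lra.
Qed.

Lemma measurable_bit_eq (c : bool) : measurable ([set x | bit x = c] : set RT).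
Proof.
by have := measurable_bit measurableT (Y := [set c]) I; rewrite setTI.
Qed.

(** Under the uniform law the first digit is a fair coin independent of the rest of
    the expansion. *)
Lemma unif01_bit (c : bool) (A : set RT) : measurable A ->
  P ([set x | bit x = c] `&` doubling @^-1` A) = ((2^-1)%:E * P A)%E.
Proof.
pose h : {mfun RT >-> RT} := @mfun_Sub _ _ RT RT doubling (mem_set measurable_doubling).
have half_ge0 : 0 <= 2^-1 :> R by [].
pose k : {nonneg R} := NngNum half_ge0.
move: A; have := @eq_measure_rays R (pushforward (mrestr P (measurable_bit_eq c)) h) (mscale k P).
move=> H A mA; rewrite setIC; apply: H => // s.
- apply: etrans (_ : _ = (2^-1)%:E * P `]s, +oo[%classic)%E _ => //.
  rewrite unif01_ray -(unif01_bit_ray c); rewrite setIC; by [].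
- rewrite /pushforward /mrestr (le_lt_trans (probability_le1 P _)) ?ltry//.
  apply: measurableI; last exact: measurable_bit_eq.
  by rewrite -[X in measurable X]setTI; exact: measurable_doubling.
Qed.


(** The digits of x of rank 0, 2, 4, ... become the first n digits of a new number. *)
Definition even_digits_upto (n : nat) (x : R) : R :=
  \sum_(j < n) (bit (iter j.*2 doubling x))%:R * 2^-1 ^+ j.+1.

Definition even_digits (x : R) : R := limn (even_digits_upto ^~ x).
Definition odd_digits (x : R) : R := even_digits (doubling x).

Lemma even_digits_uptoS n x : even_digits_upto n.+1 x =
  2^-1 * (bit x)%:R + 2^-1 * even_digits_upto n (doubling (doubling x)).
Proof.
rewrite /even_digits_upto big_ord_recl /= expr1 mulrC; congr (_ + _).
rewrite mulr_sumr; apply: eq_bigr => j _.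
by rewrite -!iterSr [in RHS]mulrCA -exprS.
Qed.

Lemma even_digits_upto_itv n x : 0 <= even_digits_upto n x <= 1.
Proof.
elim: n x => [|n IH] x; first by rewrite /even_digits_upto big_ord0 lexx ler01.
rewrite even_digits_uptoS; have /andP[] := IH (doubling (doubling x)).
by case: (bit x) => /= ? ?; apply/andP; split; lra.
Qed.

Lemma cvg_even_digits x : even_digits_upto n x @[n --> \oo] --> even_digits x.
Proof.
apply: nondecreasing_is_cvgn.
  apply/nondecreasing_seqP => n; rewrite /even_digits_upto big_ord_recr/= lerDl.
  by rewrite mulr_ge0// exprn_ge0.
by exists 1 => _ [n _ <-]; case/andP: (even_digits_upto_itv n x).
Qed.

Lemma even_digits_itv x : 0 <= even_digits x <= 1.
Proof.
apply/andP; split.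
  apply: limr_ge; first exact: cvgP (@cvg_even_digits x).
  by apply: nearW => n; case/andP: (even_digits_upto_itv n x).
apply: limr_le; first exact: cvgP (@cvg_even_digits x).
by apply: nearW => n; case/andP: (even_digits_upto_itv n x).
Qed.

Lemma even_digits_rec x :
  even_digits x = 2^-1 * (bit x)%:R + 2^-1 * odd_digits (doubling x).
Proof.
apply: (@cvg_unique _ _ (even_digits_upto n.+1 x @[n --> \oo])) => //.
  by have := @cvg_even_digits x; rewrite -(cvg_shiftS (even_digits_upto ^~ x)).
rewrite (funext (fun n => even_digits_uptoS n x)).
apply: cvgD; first exact: cvg_cst.
by apply: cvgMr; exact: cvg_even_digits.
Qed.

Lemma measurable_even_digits : measurable_fun [set: RT] (even_digits : RT -> RT).
Proof.
apply: (@measurable_fun_cvg _ _ _ _ even_digits_upto); last first.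
  by move=> x _; exact: cvg_even_digits.
move=> n; apply: measurable_sum => j; apply: measurable_funM => //.
have mi k : measurable_fun [set: RT] (iter k doubling : RT -> RT).
  elim: k => [|k IH]; first exact: measurable_id.
  exact: (measurableT_comp measurable_doubling IH).
have -> : (fun x : RT => (bit (iter j.*2 doubling x))%:R) =
   (fun b : bool => b%:R : RT) \o (bit \o iter j.*2 doubling) by [].
apply: measurableT_comp => //.
exact: measurableT_comp measurable_bit (mi _).
Qed.

Lemma measurable_odd_digits : measurable_fun [set: RT] (odd_digits : RT -> RT).
Proof. exact: measurableT_comp measurable_even_digits measurable_doubling. Qed.

Lemma unif01_bit_split (A : set RT) : measurable A ->
  (P A = P ([set x | bit x = true] `&` A) + P ([set x | bit x = false] `&` A))%E.
Proof.
move=> mA; rewrite -measureU//.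
- rewrite -setIUl (_ : _ `|` _ = setT) ?setTI//.
  by rewrite -subTset => x _ /=; case: (bit x); [left|right].
- by apply: measurableI => //; exact: measurable_bit_eq.
- by apply: measurableI => //; exact: measurable_bit_eq.
- by rewrite -subset0 => x /= [[-> _] []].
Qed.

Lemma measurable_doubling_preimage (A : set RT) : measurable A ->
  measurable (doubling @^-1` A : set RT).
Proof. by move=> mA; rewrite -[X in measurable X]setTI; exact: measurable_doubling. Qed.

Lemma unif01_doubling (A : set RT) : measurable A -> P (doubling @^-1` A) = P A.
Proof.
move=> mA; rewrite unif01_bit_split; last exact: measurable_doubling_preimage.
rewrite !unif01_bit// -ge0_muleDl//.
by rewrite -EFinD (_ : 2^-1 + 2^-1 = 1 :> R) ?mul1e//; lra.
Qed.

Lemma even_digits_ray (c : bool) s : [set x | bit x = c] `&` even_digits @^-1` `]s, +oo[%classic =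
  [set x | bit x = c] `&` doubling @^-1` (odd_digits @^-1` `](2 * s - c%:R), +oo[%classic).
Proof.
apply/seteqP; split => x /= [bx]; rewrite !in_itv/= !andbT even_digits_rec bx => h.
  by split => //; case: (c) h => /=; lra.
by split => //; case: (c) h => /=; lra.
Qed.

Lemma measurable_even_ray s : measurable (even_digits @^-1` `]s, +oo[%classic : set RT).
Proof. by rewrite -[X in measurable X]setTI; exact: measurable_even_digits. Qed.

Lemma measurable_odd_ray s : measurable (odd_digits @^-1` `]s, +oo[%classic : set RT).
Proof. by rewrite -[X in measurable X]setTI; exact: measurable_odd_digits. Qed.
Hint Resolve measurable_even_ray measurable_odd_ray measurable_bit_eq : core.

Definition joint_surv s t := fine (P (even_digits @^-1` `]s, +oo[%classic `&`
  odd_digits @^-1` `]t, +oo[%classic)).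

Lemma joint_survE s t : P (even_digits @^-1` `]s, +oo[%classic `&`
  odd_digits @^-1` `]t, +oo[%classic) = (joint_surv s t)%:E.
Proof. by rewrite /joint_surv fineK// fin_num_measure//; exact: measurableI. Qed.

(** Removing the first digit of x exchanges the roles of the even and the odd
    digits, whence the swap of the arguments. *)
Lemma joint_surv_rec s t : joint_surv s t =
  2^-1 * joint_surv t (2 * s - 1) + 2^-1 * joint_surv t (2 * s).
Proof.
apply: EFin_inj; rewrite -joint_survE EFinD !EFinM -!joint_survE.
rewrite unif01_bit_split; last exact: measurableI.
have E c : [set x | bit x = c] `&` (even_digits @^-1` `]s, +oo[%classic `&`
    odd_digits @^-1` `]t, +oo[%classic) = [set x | bit x = c] `&`
    doubling @^-1` (even_digits @^-1` `]t, +oo[%classic `&`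
      odd_digits @^-1` `](2 * s - c%:R), +oo[%classic).
  by rewrite setIA even_digits_ray preimage_setI -setIA [X in _ = _ `&` X]setIC.
rewrite !E !unif01_bit ?subr0//; exact: measurableI.
Qed.

Lemma even_digits_setT s : s < 0 -> even_digits @^-1` `]s, +oo[%classic = setT.
Proof.
move=> s0; rewrite -subTset => x _ /=; rewrite in_itv/= andbT.
by case/andP: (even_digits_itv x) => + _; exact: lt_le_trans.
Qed.

Lemma odd_digits_setT s : s < 0 -> odd_digits @^-1` `]s, +oo[%classic = setT.
Proof.
move=> s0; rewrite -subTset => x _ /=; rewrite in_itv/= andbT.
by case/andP: (even_digits_itv (doubling x)) => + _; exact: lt_le_trans.
Qed.

Lemma even_digits_set0 s : 1 <= s -> even_digits @^-1` `]s, +oo[%classic = set0.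
Proof.
move=> s1; rewrite -subset0 => x /=; rewrite in_itv/= andbT => sx.
have := lt_le_trans (le_lt_trans s1 sx) (proj2 (andP (even_digits_itv x))).
by rewrite ltxx.
Qed.

Lemma odd_digits_set0 s : 1 <= s -> odd_digits @^-1` `]s, +oo[%classic = set0.
Proof.
move=> s1; rewrite -subset0 => x /=; rewrite in_itv/= andbT => sx.
have := lt_le_trans (le_lt_trans s1 sx) (proj2 (andP (even_digits_itv (doubling x)))).
by rewrite ltxx.
Qed.

Lemma odd_digits_ray_law s : P (odd_digits @^-1` `]s, +oo[%classic) =
  P (even_digits @^-1` `]s, +oo[%classic).
Proof. exact: (unif01_doubling (measurable_even_ray s)). Qed.

Lemma joint_survC_lt0 s t : t < 0 -> joint_surv s t = joint_surv t s.
Proof.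
move=> t0; rewrite /joint_surv (even_digits_setT t0) (odd_digits_setT t0) setTI setIT.
by rewrite odd_digits_ray_law.
Qed.

Lemma joint_surv01 s t : 0 <= joint_surv s t <= 1.
Proof.
rewrite fine_ge0//= -lee_fin -joint_survE probability_le1//; exact: measurableI.
Qed.

Lemma surv01 s : 0 <= surv s <= 1.
Proof. by rewrite /surv le_max lexx/= ge_max ler01 ge_min lexx. Qed.

Lemma joint_surv_ge1l s t : 1 <= s -> joint_surv s t = 0.
Proof. by move=> s1; rewrite /joint_surv even_digits_set0// set0I measure0. Qed.

Lemma joint_surv_ge1r s t : 1 <= t -> joint_surv s t = 0.
Proof. by move=> t1; rewrite /joint_surv odd_digits_set0// setI0 measure0. Qed.

(** The tail of the even digits and [surv] solve the same equation, in which the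
    right-hand side involves only one point where they are not both 0 or both 1.
    Hence their distance is halved by each use of the equation. *)
Lemma marginal_dist n s t : t < 0 -> `|joint_surv s t - surv s| <= 2^-1 ^+ n.
Proof.
move=> t0; elim: n s => [|n IH] s.
  have := joint_surv01 s t; have := surv01 s; rewrite expr0 ler_norml.
  by move=> /andP[? ?] /andP[? ?]; apply/andP; split; lra.
rewrite joint_surv_rec -!(@joint_survC_lt0 _ t)// surv_half exprS.
have h : 0 <= 2^-1 ^+ n :> R by rewrite exprn_ge0.
have [sh|sh] := ltP s 2^-1.
  have s0 : 2 * s - 1 < 0 by lra.
  have -> : joint_surv (2 * s - 1) t = 1.
    by rewrite /joint_surv (even_digits_setT s0) (odd_digits_setT t0) setTI probability_setT.
  rewrite (@surv_le0 (2 * s - 1)) ?(ltW s0)//.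
  have := IH (2 * s); rewrite !ler_norml => /andP[? ?].
  by apply/andP; split; lra.
have s1 : 1 <= 2 * s by lra.
rewrite (joint_surv_ge1l _ s1) (@surv_ge1 (2 * s))//.
have := IH (2 * s - 1); rewrite !ler_norml => /andP[? ?].
by apply/andP; split; lra.
Qed.

Lemma eq_of_halving (x y : R) : (forall n, `|x - y| <= 2^-1 ^+ n) -> x = y.
Proof.
move=> xy; apply/eqP; rewrite -subr_eq0 -normr_le0.
have h1 : `|2^-1 : R| < 1 by rewrite ger0_norm// invf_lt1// ltr1n.
apply: (cvgr_to_ge (cvg_expr h1)); exact: nearW.
Qed.

Lemma marginal_surv s t : t < 0 -> joint_surv s t = surv s.
Proof. by move=> t0; apply: eq_of_halving => n; exact: marginal_dist. Qed.

Lemma joint_surv_out s t : (t < 0) || (1 <= t) -> joint_surv s t = surv s * surv t.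
Proof.
move=> /orP[t0|t1]; first by rewrite marginal_surv// (surv_le0 (ltW t0)) mulr1.
by rewrite joint_surv_ge1r// (surv_ge1 t1) mulr0.
Qed.

(** Same contraction argument for the joint tail and the product of the tails. *)
Lemma joint_dist n s t : `|joint_surv s t - surv s * surv t| <= 2^-1 ^+ n.
Proof.
elim: n s t => [|n IH] s t.
  have := joint_surv01 s t; have /andP[s0 s1] := surv01 s.
  have /andP[t0 t1] := surv01 t; rewrite expr0 ler_norml.
  by move=> /andP[? ?]; apply/andP; split; nra.
rewrite joint_surv_rec (surv_half s) exprS.
have h : 0 <= 2^-1 ^+ n :> R by rewrite exprn_ge0.
have [sh|sh] := ltP s 2^-1.
  have /joint_surv_out-> : (2 * s - 1 < 0) || (1 <= 2 * s - 1) by apply/orP; left; lra.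
  have := IH t (2 * s); rewrite !ler_norml => /andP[? ?].
  by apply/andP; split; nra.
have /joint_surv_out-> : (2 * s < 0) || (1 <= 2 * s) by apply/orP; right; lra.
have := IH t (2 * s - 1); rewrite !ler_norml => /andP[? ?].
by apply/andP; split; nra.
Qed.

Lemma joint_surv_prod s t : joint_surv s t = surv s * surv t.
Proof. by apply: eq_of_halving => n; exact: joint_dist. Qed.

Lemma measurable_even_preimage (A : set RT) : measurable A ->
  measurable (even_digits @^-1` A : set RT).
Proof. by move=> mA; rewrite -[X in measurable X]setTI; exact: measurable_even_digits. Qed.

Lemma measurable_odd_preimage (A : set RT) : measurable A ->
  measurable (odd_digits @^-1` A : set RT).
Proof. by move=> mA; rewrite -[X in measurable X]setTI; exact: measurable_odd_digits. Qed.

(** Equality on products of half-lines is [joint_surv_prod]; it extends to Borel sets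
    one coordinate at a time. *)
Theorem digits_independent (A B : set RT) : measurable A -> measurable B ->
  P (even_digits @^-1` A `&` odd_digits @^-1` B) = (P A * P B)%E.
Proof.
have half (t : R) (C : set RT) : measurable C ->
    P (even_digits @^-1` C `&` odd_digits @^-1` `]t, +oo[%classic) = ((surv t)%:E * P C)%E.
  pose h : {mfun RT >-> RT} := @mfun_Sub _ _ RT RT even_digits (mem_set measurable_even_digits).
  pose k : {nonneg R} := NngNum (proj1 (andP (surv01 t))).
  move: C; have := @eq_measure_rays R
    (pushforward (mrestr P (measurable_odd_ray t)) h) (mscale k P).
  move=> H C mC; apply: H => // s.
  - apply: etrans (_ : _ = (surv t)%:E * P `]s, +oo[%classic)%E _ => //.
    rewrite unif01_ray -EFinM mulrC -joint_surv_prod -joint_survE; by [].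
  - rewrite /pushforward /mrestr (le_lt_trans (probability_le1 P _)) ?ltry//.
    apply: measurableI => //; exact: measurable_even_preimage.
move=> mA.
pose h : {mfun RT >-> RT} := @mfun_Sub _ _ RT RT odd_digits (mem_set measurable_odd_digits).
pose k : {nonneg R} := NngNum (fine_ge0 (measure_ge0 P A)).
have kE : k%:num%:E = P A by rewrite /= fineK// fin_num_measure.
move: B; have := @eq_measure_rays R
  (pushforward (mrestr P (measurable_even_preimage mA)) h) (mscale k P).
move=> H B mB; rewrite setIC -kE; apply: H => // s.
- apply: etrans (_ : _ = k%:num%:E * P `]s, +oo[%classic)%E _ => //.
  by rewrite kE unif01_ray muleC -half// setIC.
- rewrite /pushforward /mrestr (le_lt_trans (probability_le1 P _)) ?ltry//.
  apply: measurableI; last exact: measurable_even_preimage.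
  exact: measurable_odd_preimage.
Qed.

Lemma even_digits_law (A : set RT) : measurable A -> P (even_digits @^-1` A) = P A.
Proof.
move=> mA; have := digits_independent mA measurableT.
by rewrite preimage_setT setIT probability_setT mule1.
Qed.

Lemma odd_digits_law (A : set RT) : measurable A -> P (odd_digits @^-1` A) = P A.
Proof.
move=> mA; have := digits_independent measurableT mA.
by rewrite preimage_setT setTI probability_setT mul1e.
Qed.

(** Each step keeps the even digits as a new variable and goes on with the odd ones. *)
Definition uniforms (i : nat) (x : R) : R := even_digits (iter i odd_digits x).

Lemma uniformsS i x : uniforms i.+1 x = uniforms i (odd_digits x).
Proof. by rewrite /uniforms iterSr. Qed.

Lemma measurable_uniforms i : measurable_fun [set: RT] (uniforms i : RT -> RT).
Proof.
apply: measurableT_comp measurable_even_digits _.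
elim: i => [|i IH]; first exact: measurable_id.
exact: measurableT_comp measurable_odd_digits IH.
Qed.

Lemma measurable_uniforms_preimage i (A : set RT) : measurable A ->
  measurable (uniforms i @^-1` A : set RT).
Proof. by move=> mA; rewrite -[X in measurable X]setTI; exact: measurable_uniforms. Qed.

Lemma uniforms_prod n (B : nat -> set RT) : (forall i, measurable (B i)) ->
  P (\bigcap_(i < n) uniforms i @^-1` B i) = (\prod_(i < n) P (B i))%E.
Proof.
elim: n B => [|n IH] B mB.
  by rewrite bigcap_mkord !big_ord0 probability_setT.
rewrite (_ : \bigcap_(i < n.+1) _ = even_digits @^-1` B 0%N `&`
    odd_digits @^-1` (\bigcap_(i < n) uniforms i @^-1` B i.+1)).
  rewrite digits_independent//; last first.
    apply: fin_bigcap_measurable; first exact: finite_II.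
    by move=> i _; exact: measurable_uniforms_preimage.
  by rewrite IH// big_ord_recl.
apply/seteqP; split => x /=.
  move=> H; split; first exact: (H 0%N).
  by move=> i /= ni; have := H i.+1 ni; rewrite /= uniformsS.
by move=> [H0 H] [|i] /= ni //; rewrite uniformsS; exact: (H i ni).
Qed.

Lemma uniforms_law i (A : set RT) : measurable A -> P (uniforms i @^-1` A) = P A.
Proof.
elim: i => [|i IH] mA; first exact: even_digits_law.
rewrite -[RHS](IH mA) -(odd_digits_law (measurable_uniforms_preimage i mA)).
by congr (P _); apply/seteqP; split => x /=; rewrite uniformsS.
Qed.

Lemma uniforms_independent (J : {fset nat}) (B : nat -> set RT) :
  (forall i, measurable (B i)) ->
  P (\bigcap_(i in [set` J]) uniforms i @^-1` B i) =
  (\big[*%E/1]_(i <- J) P (uniforms i @^-1` B i))%E.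
Proof.
move=> mB.
pose n := (\max_(i <- J) i).+1.
have Jn i : i \in J -> (i < n)%N by move=> iJ; rewrite ltnS; exact: leq_bigmax_seq.
pose C i := if i \in J then B i else setT.
have mC i : measurable (C i) by rewrite /C; case: ifP.
transitivity (P (\bigcap_(i < n) uniforms i @^-1` C i)).
  congr (P _); apply/seteqP; split => x /= H i /= iJ.
    by rewrite /C; case: ifP => // iJ'; exact: H.
  by have := H i (Jn _ iJ); rewrite /C iJ.
rewrite uniforms_prod// -(big_mkord xpredT (fun i => P (C i))).
rewrite (eq_bigr (fun i => if i \in J then P (B i) else 1%E)); last first.
  by move=> i _; rewrite /C; case: ifP => // _; exact: probability_setT.
rewrite -big_mkcond -big_filter (perm_big (enum_fset J)).
  by apply: eq_bigr => i _; rewrite uniforms_law.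
apply: uniq_perm; [exact: filter_uniq (iota_uniq _ _)|exact: fset_uniq|].
move=> i; rewrite mem_filter mem_index_iota/=.
by case: (boolP (i \in J)) => // /Jn ->.
Qed.

End uniform_measure.

(** * Existence of independent sequences with a given law *)

Section quantile.
Context (R : realType) (mu : law R).
Local Notation RT := (measurableTypeR R).
Local Notation P := (@unif01 R : law R).

Definition distr_fun (x : R) : R := fine (mu `]-oo, x]%classic).
Local Notation F := distr_fun.

Let idR : {RV mu >-> R} := @mfun_Sub _ _ RT R idfun (mem_set (@measurable_id _ RT setT)).

Let FE x : (F x)%:E = cdf idR x.
Proof. by rewrite /distr_fun fineK// fin_num_measure. Qed.

Let F_nd x y : x <= y -> F x <= F y.
Proof. by move=> xy; rewrite -lee_fin !FE; exact: cdf_nondecreasing. Qed.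

Let F_rc x : F y @[y --> x^'+] --> F x.
Proof.
have := @cdf_right_continuous _ _ _ _ idR x; rewrite -FE -(funext FE).
exact: fine_cvg.
Qed.

Let F_Ny : F @ -oo --> (0 : R).
Proof. by have := @cvg_cdfNy0 _ _ _ _ idR; rewrite -(funext FE); exact: fine_cvg. Qed.

Let F_y : F @ +oo --> (1 : R).
Proof. by have := @cvg_cdfy1 _ _ _ _ idR; rewrite -(funext FE); exact: fine_cvg. Qed.

Definition quantile (u : R) : R :=
  if 0 < u < 1 then sup [set x | F x < u] else 0.

(** Right continuity of the distribution function is what makes this an equivalence
    with strict inequalities on both sides. *)
Lemma quantile_gt u x : 0 < u < 1 -> (x < quantile u) = (F x < u).
Proof.
move=> u01; rewrite /quantile u01; have /andP[u0 u1] := u01.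
set E := [set x | F x < u].
have hE : has_sup E.
  split.
    have [M [_ HM]] : \forall y \near -oo, F y < u by exact: cvgr_lt F_Ny _ u0.
    by exists (M - 1); apply: HM; rewrite ltrBlDr ltrDl.
  have [M [_ HM]] : \forall y \near +oo, u < F y by exact: cvgr_gt F_y _ u1.
  exists (M + 1) => y Ey; rewrite leNgt; apply/negP => My.
  have : u < F y by apply: HM; rewrite (lt_trans _ My)// ltrDl.
  by move=> /(lt_trans Ey); rewrite ltxx.
apply/idP/idP => [/(sup_gt hE.1)|Fx].
  by move=> [y Ey xy]; exact: le_lt_trans (F_nd (ltW xy)) Ey.
have [e /= e0 He] : \forall y \near x^'+, F y < u by exact: cvgr_lt (@F_rc x) _ Fx.
have xe : F (x + e / 2) < u.
  apply: He; rewrite /= ?ltrDl ?divr_gt0//.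
  by rewrite opprD addNKr normrN gtr0_norm ?divr_gt0// gtr_pMr// invf_lt1// ltr1n.
apply: (@lt_le_trans _ _ (x + e / 2)); first by rewrite ltrDl divr_gt0.
exact: (ub_le_sup hE.2).
Qed.

Lemma quantile_preimage_ray x : quantile @^-1` `]x, +oo[%classic =
  (`]0, 1[%classic `&` `](F x), +oo[%classic) `|`
  (~` `]0, 1[%classic `&` (if x < 0 then setT else set0)).
Proof.
apply/seteqP; split => u /=; rewrite !in_itv/= !andbT.
  have [u01|u01] := boolP (0 < u < 1).
    by rewrite quantile_gt// => ?; left.
  rewrite /quantile (negbTE u01) => x0; right.
  by rewrite x0; split => //; exact/negP.
move=> [[u01 Fx]|[/negP/negbTE u01]]; first by rewrite quantile_gt.
by rewrite /quantile u01; case: ifP.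
Qed.

Lemma measurable_quantile : measurable_fun [set: RT] (quantile : RT -> RT).
Proof.
move=> mD; apply: (measurability _ (RGenOInfty.measurableE R)) => //.
move=> _ [_ [x ->] <-]; rewrite setTI quantile_preimage_ray.
apply: measurableU; first exact: measurableI.
apply: measurableI; first exact: measurableC.
by case: ifP.
Qed.

Lemma unif01_oo : P (~` `]0, 1[%classic) = 0%E.
Proof.
rewrite probability_setC// (_ : P _ = 1%E) ?subee//.
rewrite /= /unif01 /mrestr setIidl.
  by rewrite lebesgue_measure_itv/= lte01 oppr0 adde0.
by move=> x /=; rewrite !in_itv/= => /andP[/ltW -> /ltW ->].
Qed.

Lemma quantile_law (A : set RT) : measurable A -> P (quantile @^-1` A) = mu A.
Proof.
pose h : {mfun RT >-> RT} := @mfun_Sub _ _ RT RT quantile (mem_set measurable_quantile).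
move: A; have := @eq_measure_rays R (pushforward P h) mu; apply => x.
  change (P (quantile @^-1` `]x, +oo[%classic) = mu `]x, +oo[%classic).
  rewrite quantile_preimage_ray.
  have mN : measurable (~` `]0, 1[%classic : set RT) by exact: measurableC.
  have mU : measurable (if x < 0 then setT else set0 : set RT) by case: ifP.
  have N0 (B : set RT) : measurable B -> P (~` `]0, 1[%classic `&` B) = 0%E.
    move=> mB; apply/eqP; rewrite eq_le measure_ge0 andbT -unif01_oo.
    by apply: le_measure => //; apply: mem_set => //; exact: measurableI.
  rewrite measureU0//; last 3 first.
  - exact: measurableI.
  - exact: measurableI.
  - exact: N0.
  have : P `](F x), +oo[%classic = mu `]x, +oo[%classic.
    rewrite unif01_ray surv_mid; last first.
      by rewrite fine_ge0//= -lee_fin FE cdf_le1.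
    rewrite -setCitvl probability_setC// EFinB FE.
    by [].
  move=> <-; rewrite -[X in _ = _ X]setTI -(setUv `]0, 1[%classic) setIUl.
  rewrite measureU0//.
  - exact: measurableI.
  - exact: measurableI.
  - exact: N0.
rewrite /pushforward (le_lt_trans (probability_le1 P _)) ?ltry//.
by rewrite -[X in measurable X]setTI; exact: measurable_quantile.
Qed.

End quantile.

Section geometric_on_nat.
Context (R : realType) (p : R) (p01 : 0 < p < 1).

Let c_ge0 k : 0 <= p * (1 - p) ^+ k.
Proof. by case/andP: p01 => p0 p1; rewrite mulr_ge0 ?exprn_ge0 ?subr_ge0// ltW. Qed.

Definition geometric_nat : set nat -> \bar R :=
  mseries (fun k => mscale (NngNum (c_ge0 k)) (dirac k.+1)) 0.

HB.instance Definition _ := Measure.on geometric_nat.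

Let termE k (A : set nat) : mscale (NngNum (c_ge0 k)) (dirac k.+1) A =
  (p * (1 - p) ^+ k * (k.+1 \in A)%:R)%:E.
Proof. by []. Qed.

Let geometric_nat_setT : geometric_nat setT = 1%E.
Proof.
have [p0 p1] := andP p01; rewrite /geometric_nat /mseries.
rewrite (eq_eseriesr (g := fun k => p%:E * ((1 - p) ^+ k)%:E)%E); last first.
  by move=> k _; apply: (etrans (termE k setT)); rewrite mem_set// mulr1 EFinM.
rewrite nneseriesZl; last by move=> k _; rewrite lee_fin exprn_ge0// subr_ge0 ltW.
rewrite geometric_eseries; last by rewrite subr_ge0 (ltW p1)/= gtrBl.
by rewrite subKr -EFinM divff// gt_eqF.
Qed.

HB.instance Definition _ := Measure_isProbability.Build _ _ _
  geometric_nat geometric_nat_setT.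

Lemma geometric_natE k : geometric_nat [set k.+1] = (p * (1 - p) ^+ k)%:E.
Proof.
rewrite /geometric_nat /mseries (@nneseriesD1 _ _ k)//.
rewrite [X in (_ + X)%E]eseries0 ?adde0.
  by apply: (etrans (termE k _)); rewrite mem_set// mulr1.
move=> j _ jk; apply: (etrans (termE j _)); rewrite memNset ?mulr0//= => -[jk'].
by rewrite jk' eqxx in jk.
Qed.

End geometric_on_nat.

Section iid_existence.
Context (R : realType) (mu : law R) (p : R) (p01 : 0 < p < 1).
Local Notation RT := (measurableTypeR R).

(** G is the first coordinate of a product space, and the sequence lives on the
    second one as quantiles of independent uniform variables. *)
Theorem iid_geometric_exists : exists (d : measure_display) (Omega : measurableType d)
    (P : probability Omega R) (X : nat -> {RV P >-> RT}) (G : {RV P >-> nat}),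
    [/\ mutually_independent X, identically_distributed X, geometric_variable p G,
        independent_of_sequence G X &
        forall A, measurable A -> P (X 0%N @^-1` A) = mu A].
Proof.
pose U := @unif01 R : law R.
pose N := geometric_nat p01 : probability nat R.
pose Om : measurableType _ := (nat * RT)%type.
pose P : probability Om R := (N \x U)%E.
pose Y i : RT -> RT := quantile mu \o uniforms i.
have mY i : measurable_fun setT (Y i).
  exact: measurableT_comp (@measurable_quantile R mu) (@measurable_uniforms R i).
have mX i : measurable_fun [set: Om] (Y i \o snd).
  exact: measurableT_comp (mY i) measurable_snd.
pose X i : {RV P >-> RT} := @mfun_Sub _ _ Om RT (Y i \o snd) (mem_set (mX i)).
pose G : {RV P >-> nat} := @mfun_Sub _ _ Om nat fst (mem_set measurable_fst).
have mYA i (A : set RT) : measurable A -> measurable (Y i @^-1` A).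
  by move=> mA; rewrite -[Z in measurable Z]setTI; exact: mY.
have PE (A : set nat) (B : set RT) : measurable B -> P (A `*` B) = (N A * U B)%E.
  by move=> mB; exact: product_measure1E.
have Psnd (B : set RT) : measurable B -> P (snd @^-1` B) = U B.
  move=> mB; rewrite (_ : _ @^-1` _ = setT `*` B).
    by rewrite PE// [Z in (Z * _)%E]probability_setT mul1e.
  by apply/seteqP; split => -[? ?] //= [].
have UY i (A : set RT) : measurable A -> U (Y i @^-1` A) = mu A.
  move=> mA; rewrite -(quantile_law mu mA) -[RHS](uniforms_law i)//.
  by rewrite -[Z in measurable Z]setTI; exact: measurable_quantile.
have PX i (A : set RT) : measurable A -> P (X i @^-1` A) = mu A.
  move=> mA; rewrite -(UY i)// -(Psnd _ (mYA i A mA)); by [].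
exists _, Om, P, X, G; split.
- move=> J B mB.
  transitivity (U (\bigcap_(i in [set` J]) uniforms i @^-1` (quantile mu @^-1` B i))).
    rewrite -Psnd//; last first.
      apply: fin_bigcap_measurable => [|i _]; first exact: finite_fset.
      exact: (mYA i _ (mB i)).
  rewrite uniforms_independent//; last first.
    move=> i; rewrite -[Z in measurable Z]setTI.
    exact: (@measurable_quantile _ mu measurableT _ (mB i)).
  apply: eq_bigr => i _; apply: (etrans (UY i _ (mB i))).
  by apply/esym; exact: (PX i _ (mB i)).
- move=> i j B mB; apply: (etrans (PX i _ mB)).
  by apply/esym; exact: (PX j _ mB).
- move=> [//|k] _ /=; rewrite -geometric_natE.
  have := PE [set k.+1] setT measurableT; rewrite [Z in (_ * Z)%E]probability_setT mule1.
  move=> <-; congr (P _).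
  by apply/seteqP; split => -[? ?] //= [].
- move=> B A sA.
  have [A0 [mA0 ->]] : exists A0 : set RT, measurable A0 /\ A = snd @^-1` A0.
    pose C : set (set Om) :=
      [set A | exists A0 : set RT, measurable A0 /\ A = snd @^-1` A0].
    have sC : sigma_algebra setT C.
      split.
      - by exists set0; split => //; rewrite preimage_set0.
      - move=> _ [A0 [mA0 ->]]; exists (~` A0); split; first exact: measurableC.
        by rewrite setTD preimage_setC.
      - move=> F FC; have [F0 F0P] := choice FC.
        exists (\bigcup_n F0 n); split.
          by apply: bigcupT_measurable => n; case: (F0P n).
        by rewrite preimage_bigcup; apply: eq_bigcupr => n _; case: (F0P n).
    apply: (sA C); split => // _ [i _ [D mD <-]]; rewrite setTI.
    by exists (Y i @^-1` D); split; first exact: mYA.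
  have -> : G @^-1` B `&` snd @^-1` A0 = B `*` A0 by [].
  have -> : G @^-1` B = B `*` setT by apply/seteqP; split => -[? ?] //= [].
  by rewrite !PE// [Z in (_ = _ * Z * _)%E]probability_setT mule1 Psnd.
- by move=> A mA; exact: PX.
Qed.

End iid_existence.

(** * Mixtures of laws *)

Section mixture.
Context d (T : measurableType d) (R : realType) (m : {measure set T -> \bar R}).
Local Notation RT := (measurableTypeR R).
Variables (D : set T) (mD : measurable D) (w : T -> R) (kappa : T -> law R).
Hypotheses (w_ge0 : forall t, 0 <= w t) (mw : measurable_fun setT w).
Hypothesis mkappa : forall A : set RT, measurable A -> measurable_fun setT (kappa ^~ A).
Hypothesis w_total : (\int[m]_(t in D) (w t)%:E = 1)%E.

Definition mixture (A : set RT) : \bar R := (\int[m]_(t in D) ((w t)%:E * kappa t A))%E.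

Let m_weighted (g : T -> \bar R) : measurable_fun setT g ->
  measurable_fun D (fun t => (w t)%:E * g t)%E.
Proof.
move=> mg; apply: measurable_funTS; apply: emeasurable_funM => //.
exact/measurable_EFinP.
Qed.

Let mixture0 : mixture set0 = 0%E.
Proof. by rewrite /mixture integral0_eq// => t _; rewrite measure0 mule0. Qed.

Let mixture_ge0 A : (0 <= mixture A)%E.
Proof. by apply: integral_ge0 => t _; rewrite mule_ge0// lee_fin. Qed.

Let mixture_sigma_additive : semi_sigma_additive mixture.
Proof.
move=> F mF tF mUF; rewrite /mixture.
rewrite (_ : (\int[m]_(t in D) _)%E =
    (\sum_(k <oo) \int[m]_(t in D) ((w t)%:E * kappa t (F k)))%E).
  by apply: is_cvg_nneseries => k _ _; exact: mixture_ge0.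
rewrite -integral_nneseries//; last 2 first.
- by move=> k; apply: m_weighted; exact: mkappa.
- by move=> k t _; rewrite mule_ge0// lee_fin.
apply: eq_integral => t _; rewrite measure_semi_bigcup// nneseriesZl//.
Qed.

HB.instance Definition _ := isMeasure.Build _ _ _ mixture
  mixture0 mixture_ge0 mixture_sigma_additive.

Let mixture_setT : mixture setT = 1%E.
Proof.
by rewrite /mixture -w_total; apply: eq_integral => t _; rewrite probability_setT mule1.
Qed.

HB.instance Definition _ := Measure_isProbability.Build _ _ _ mixture mixture_setT.

Definition mixture_law : law R := mixture.

Import HBNNSimple.

Let integral_mixture_nnsfun (f : {nnsfun RT >-> R}) :
  (\int[mixture_law]_x (f x)%:E = \int[m]_(t in D) ((w t)%:E * \int[kappa t]_x (f x)%:E))%E.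
Proof.
have E (mu : law R) : (\int[mu]_x (f x)%:E =
    \sum_(r \in range f) (r%:E * mu (f @^-1` [set r])))%E.
  under eq_integral do rewrite fimfunE -fsumEFin//.
  rewrite ge0_integral_fsum//; last 2 first.
  - by move=> r; exact/measurable_EFinP/measurableT_comp.
  - by move=> r z _; rewrite EFinM nnfun_muleindic_ge0.
  apply: eq_fsbigr => r _.
  rewrite (integralZl_indic _ (fun r => f @^-1` [set r]))//; last first.
    by move=> r0; rewrite preimage_nnfun0.
  by rewrite integral_indic// setIT.
have pos (mu : law R) r : (0 <= r%:E * mu (f @^-1` [set r]))%E.
  by apply: (mulemu_ge0 (fun r => f @^-1` [set r])) => r0; exact: preimage_nnfun0.
rewrite E; under eq_integral do rewrite E ge0_mule_fsumr//.
rewrite ge0_integral_fsum//; last 2 first.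
- by move=> r; apply: m_weighted; apply: measurable_funeM; exact: mkappa.
- by move=> r t _; rewrite mule_ge0// lee_fin.
apply: eq_fsbigr => r /set_mem[x _ <-].
rewrite -ge0_integralZl_EFin//.
- by apply: eq_integral => t _; rewrite muleCA.
- by move=> t _; rewrite mule_ge0// lee_fin.
- by apply: m_weighted; exact: mkappa.
Qed.

(** True for simple functions by linearity, then by monotone convergence. *)
Lemma integral_mixture (f : RT -> \bar R) : measurable_fun setT f ->
  (forall x, 0 <= f x)%E ->
  (\int[mixture_law]_x f x = \int[m]_(t in D) ((w t)%:E * \int[kappa t]_x f x))%E.
Proof.
move=> mf f0.
pose f_ := nnsfun_approx measurableT mf.
have mf_ n : measurable_fun setT (fun x : RT => (f_ n x)%:E).
  exact/measurable_EFinP.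
have fE (mu : law R) : (\int[mu]_x f x)%E = (lim (\int[mu]_x (f_ n x)%:E @[n --> \oo]))%E.
  rewrite -monotone_convergence//=.
  - by apply: eq_integral => x _; apply/esym/cvg_lim => //; exact: cvg_nnsfun_approx.
  - by move=> n x _; rewrite lee_fin.
  - by move=> x _ a b ab; rewrite lee_fin; exact/lefP/nd_nnsfun_approx.
have nd (mu : law R) : {homo (fun n => (\int[mu]_x (f_ n x)%:E)%E) : a b / (a <= b)%N >-> (a <= b)%E}.
  move=> a b ab; apply: ge0_le_integral => //.
  - by move=> x _; rewrite lee_fin.
  - by move=> x _; rewrite lee_fin; exact/lefP/nd_nnsfun_approx.
have pos (mu : law R) n : (0 <= \int[mu]_x (f_ n x)%:E)%E.
  by apply: integral_ge0 => x _; rewrite lee_fin.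
rewrite fE (_ : (fun n => _) = (fun n =>
   \int[m]_(t in D) ((w t)%:E * \int[kappa t]_x (f_ n x)%:E))%E); last first.
  by apply/funext => n; exact: integral_mixture_nnsfun.
rewrite -monotone_convergence//.
- apply: eq_integral => t _; rewrite fE limeMl//.
  exact: ereal_nondecreasing_is_cvgn (nd (kappa t)).
- move=> n; apply: m_weighted; apply: measurable_fun_integral_kernel => //.
  by move=> x; rewrite lee_fin.
- by move=> n t _; rewrite mule_ge0// lee_fin.
- by move=> t _ a b ab; rewrite lee_wpmul2l ?lee_fin//; exact: nd.
Qed.

End mixture.

(** * Step functions of the number of summands *)

Section exponential_weight.
Context (R : realType).
Local Notation RT := (measurableTypeR R).
Local Notation leb := (@lebesgue_measure R).

Definition exp_weight (theta t : R) : R := theta * expR (- (theta * t)).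

Lemma continuous_exp_weight theta : continuous (exp_weight theta).
Proof.
move=> x; apply: cvgM; first exact: cvg_cst.
exact: continuous_expRN.
Qed.

Lemma measurable_exp_weight theta : measurable_fun [set: RT] (exp_weight theta : RT -> R).
Proof. exact: measurable_continuous (@continuous_exp_weight theta). Qed.

Lemma exp_weight_total theta : 0 < theta ->
  (\int[leb]_(t in `]0%R, +oo[) (exp_weight theta t)%:E = 1)%E.
Proof.
move=> theta0; rewrite integral_itv_obnd_cbnd; last first.
  apply: measurable_funTS; apply/measurable_EFinP; exact: measurable_exp_weight.
rewrite integral_mkcond -(integral_exponential_pdf theta0).
apply: eq_integral => t _; rewrite /exponential_pdf /patch.
by case: ifP => // _; rewrite /exp_weight -mulNr.
Qed.

(** [steps a] is constant on the intervals ]k (1 - a), (k + 1) (1 - a)], of length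
    1 - a: this is what turns sums with weights 1 - a into integrals. *)
Lemma steps_itv (a t : R) (k : nat) : a < 1 ->
  t \in `](k%:R * (1 - a)), (k.+1%:R * (1 - a))] -> steps a t = k.+1.
Proof.
move=> a1; rewrite in_itv/= => /andP[kt tk].
have h0 : 0 < 1 - a by rewrite subr_gt0.
rewrite /steps (_ : Num.ceil _ = k.+1%:Z)//; apply/eqP.
rewrite ceil_eq ltr_pdivlMr// ler_pdivrMr// tk andbT.
by rewrite (_ : _ - 1 = k%:Z) ?kt// -addn1 PoszD addrK.
Qed.

Lemma bigcup_steps (h : R) : 0 < h ->
  \bigcup_k `](k%:R * h), (k.+1%:R * h)]%classic = `]0, +oo[%classic :> set R.
Proof.
move=> h0; apply/seteqP; split => t /=; rewrite in_itv/=.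
  by move=> [k _ /=]; rewrite in_itv/= => /andP[kt _];
    rewrite andbT (le_lt_trans _ kt)// mulr_ge0// ltW.
rewrite andbT => t0.
have c0 : 0 < Num.ceil (t / h) by rewrite ceil_gt0 divr_gt0.
have [k kE] : exists k : nat, Num.ceil (t / h) = k.+1%:Z.
  by case: (Num.ceil (t / h)) c0 => [[|k]|k] // _; exists k.
exists k => //=; have /eqP := kE; rewrite ceil_eq ltr_pdivlMr// ler_pdivrMr//.
by rewrite (_ : _ - 1 = k%:Z) ?in_itv// -addn1 PoszD addrK.
Qed.

Lemma trivIset_steps (h : R) : 0 < h ->
  trivIset setT (fun k : nat => `](k%:R * h), (k.+1%:R * h)]%classic : set R).
Proof.
move=> h0; apply: ltn_trivIset => i j ij; rewrite -subset0 => t /= [].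
rewrite !in_itv/= => /andP[_ ti] /andP[jt _].
have := lt_le_trans jt ti; rewrite ltr_pM2r// ltr_nat.
by rewrite ltnS leqNgt ij.
Qed.

Lemma measurable_steps d (T : measurableType d) (a : R) (u : nat -> T) : a < 1 ->
  measurable_fun (`]0, +oo[%classic : set RT) (fun t : RT => u (steps a t)).
Proof.
move=> a1; have h0 : 0 < 1 - a by rewrite subr_gt0.
rewrite -(bigcup_steps h0); apply/measurable_fun_bigcup => // k.
apply: (eq_measurable_fun (cst (u k.+1))) => //.
by move=> t /set_mem tk; rewrite /= (steps_itv a1 tk).
Qed.

Lemma integral_steps (a : R) (u : nat -> \bar R) : a < 1 -> (forall k, 0 <= u k)%E ->
  (\int[leb]_(t in `]0%R, +oo[) u (steps a t) = \sum_(k <oo) (1 - a)%:E * u k.+1)%E.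
Proof.
move=> a1 u0; have h0 : 0 < 1 - a by rewrite subr_gt0.
rewrite -(bigcup_steps h0) ge0_integral_bigcup//; last 2 first.
- by rewrite (bigcup_steps h0); exact: measurable_steps.
- exact: trivIset_steps.
apply: eq_eseriesr => k _.
rewrite (eq_integral (cst (u k.+1))); last first.
  by move=> t /set_mem tk; rewrite (steps_itv a1 tk).
rewrite integral_cst//= lebesgue_measure_itv/= lte_fin ltr_pM2r// ltr_nat ltnSn.
by rewrite -EFinD -mulrBl -natrB// subSnn mul1r muleC.
Qed.

Lemma steps_bounds (a t : R) : a < 1 -> 0 < t ->
  t <= (steps a t)%:R * (1 - a) < t + (1 - a).
Proof.
move=> a1 t0; have h0 : 0 < 1 - a by rewrite subr_gt0.
have : (`]0, +oo[%classic : set R) t by rewrite /= in_itv/= t0.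
rewrite -(bigcup_steps h0) => -[k _ tk].
rewrite (steps_itv a1 tk); move: tk; rewrite /= in_itv/= => /andP[kt ->]/=.
by rewrite -natr1 mulrDl mul1r ltrD2r.
Qed.

Lemma expr_steps_le (a t : R) : 0 < a < 1 -> 0 < t -> a ^+ steps a t <= expR (- t).
Proof.
move=> /andP[a0 a1] t0; have /andP[tk _] := steps_bounds a1 t0.
have ae : a <= expR (- (1 - a)).
  by rewrite (le_trans _ (expR_ge1Dx _))// opprB addrC subrK.
apply: (@le_trans _ _ (expR (- (1 - a)) ^+ steps a t)).
  by rewrite lerXn2r// nnegrE ?expR_ge0// ltW.
by rewrite -expRM_natl ler_expR mulrN lerN2.
Qed.

Lemma expr_steps_ge (a t : R) : 0 < a < 1 -> 0 < t ->
  expR (- ((t + (1 - a)) / a)) <= a ^+ steps a t.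
Proof.
move=> /andP[a0 a1] t0; have /andP[_ tk] := steps_bounds a1 t0.
have ae : expR (- ((1 - a) / a)) <= a.
  rewrite expRN -[leRHS]invrK lef_pV2 ?posrE ?expR_gt0 ?invr_gt0//.
  rewrite (le_trans _ (expR_ge1Dx _))// mulrBl mul1r divff ?gt_eqF//.
  by rewrite addrC subrK.
apply: (@le_trans _ _ (expR (- ((1 - a) / a)) ^+ steps a t)); last first.
  by rewrite lerXn2r// nnegrE ?expR_ge0// ltW.
rewrite -expRM_natl ler_expR mulrN lerN2 mulrA ler_pM2r ?invr_gt0//.
exact: ltW.
Qed.

Lemma cvg_expr_steps (a : nat -> R) (t : R) : (forall n, 0 < a n < 1) ->
  a n @[n --> \oo] --> (1 : R) -> 0 < t ->
  a n ^+ steps (a n) t @[n --> \oo] --> expR (- t).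
Proof.
move=> a01 a1 t0.
apply: (@squeeze_cvgr _ _ _ _ (fun n => expR (- ((t + (1 - a n)) / a n))) (cst (expR (- t)))).
- apply: nearW => n; rewrite expr_steps_ge//=; exact: expr_steps_le.
- apply: continuous_cvg; first exact: continuous_expR.
  apply: cvgN; rewrite -[X in _ --> X]divr1; apply: cvgM; last first.
    by apply: cvgV; first exact: oner_neq0.
  rewrite -[X in _ --> X]addr0 -(subrr 1); apply: cvgD; first exact: cvg_cst.
  by apply: cvgB => //; exact: cvg_cst.
- exact: cvg_cst.
Qed.

End exponential_weight.

(** * Limits of geometric laws are geometrically infinitely divisible *)

Section mixture_of_powers.
Context (R : realType).
Local Notation RT := (measurableTypeR R).
Local Notation leb := (@lebesgue_measure R).

Lemma eq_laplace (mu nu : law R) l : (forall A : set RT, measurable A -> mu A = nu A) ->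
  laplace mu l = laplace nu l.
Proof.
move=> mn; rewrite /laplace /Rintegral; congr fine.
by apply: eq_measure_integral => A mA _; exact: mn.
Qed.

(** Dynkin's lemma reduces the claim to half-lines, whose masses are limits of means
    of continuous functions. *)
Lemma measurable_law_family d (T : measurableType d) (D : set T) (kappa : T -> law R) :
  measurable D ->
  (forall f : R -> R, continuous f -> (exists M, forall x, `|f x| <= M) ->
    measurable_fun D (fun t => \int[kappa t]_x f x)) ->
  forall A : set RT, measurable A -> measurable_fun D (fun t => kappa t A).
Proof.
move=> mD mf A mA.
have sA : <<s @RGenOInfty.G R >> A by have := mA; rewrite RGenOInfty.measurableE.
move: A sA {mA}; apply: dynkin_induction.
- exact: RGenOInfty.measurableE.
- move=> _ _ [x ->] [y ->]; exists (Num.max x y).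
  by rewrite predeqE => z /=; rewrite !in_itv/= !andbT gt_max; split => [[-> ->]|/andP[]].
- apply: (eq_measurable_fun (cst 1%E)) => // t _.
  by rewrite probability_setT.
- move=> _ [x ->].
  apply: (@emeasurable_fun_cvg _ _ _ _ (fun n t => (\int[kappa t]_y (step_up x n y)%:E)%E)).
    move=> n; apply: (eq_measurable_fun (fun t => (\int[kappa t]_y step_up x n y)%:E)).
      move=> t _; rewrite fineK//; apply: integrable_fin_num => //.
      apply: (@integrable_bounded _ _ _ 1) => [|y].
        by apply: measurable_continuous; exact: continuous_step_up.
      by case/andP: (step_up01 x n y) => s0 s1; rewrite ger0_norm.
    apply/measurable_EFinP; apply: mf; first exact: continuous_step_up.
    by exists 1 => y; case/andP: (step_up01 x n y) => s0 s1; rewrite ger0_norm.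
  by move=> t _; exact: integral_ray.
- move=> S mS mkS; apply: (eq_measurable_fun (fun t => 1%E - kappa t S)%E).
    by move=> t _; rewrite probability_setC.
  by apply: emeasurable_funB.
- move=> F mF tF mkF.
  apply: (@emeasurable_fun_cvg _ _ _ _ (fun n t => (\sum_(0 <= i < n) kappa t (F i))%E)).
    by move=> n; apply: emeasurable_sum => i; exact: mkF.
  move=> t _; apply: measure_semi_sigma_additive => //.
  exact: bigcupT_measurable.
Qed.

End mixture_of_powers.

Section limit_is_gid.
Context (R : realType).
Local Notation RT := (measurableTypeR R).
Local Notation leb := (@lebesgue_measure R).
Variables (a : nat -> R) (a01 : forall n, 0 < a n < 1) (pi_ : nat -> nat -> law R)
  (nu : law R) (nt : R -> law R).
Hypotheses (a1 : a n @[n --> \oo] --> (1 : R)) (snu : supported_on `[0, +oo[ nu).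
Hypothesis ntP : forall t, 0 < t -> is_convolution_power nu t (nt t) /\
  weak_cvg (fun n => convolution_upto (pi_ n) (steps (a n) t)) (nt t).
Hypothesis nt0 : forall t, t <= 0 -> nt t = (dirac (0 : RT) : law R).
Local Notation D := (`]0, +oo[%classic : set RT).

Let mD : measurable D. Proof. by []. Qed.

(** Measurability in t of the powers nu^t comes from the hypothesis of convergence:
    their means are limits of step functions. *)
Lemma measurable_powers_integral (f : R -> R) : continuous f ->
  (exists M, forall x, `|f x| <= M) ->
  measurable_fun D (fun t : RT => \int[nt t]_x f x).
Proof.
move=> fc fb; apply: (@measurable_fun_cvg _ _ _ _
  (fun n t => \int[convolution_upto (pi_ n) (steps (a n) t)]_x f x)).
  move=> n; apply: (measurable_steps (fun k => \int[convolution_upto (pi_ n) k]_x f x)).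
  by case/andP: (a01 n).
move=> t /=; rewrite in_itv/= andbT => t0.
exact: (ntP t0).2.
Qed.

Lemma measurable_powers (A : set RT) : measurable A ->
  measurable_fun [set: RT] (fun t : RT => nt t A).
Proof.
move=> mA; rewrite -(setUv D); apply/measurable_funU => //; first exact: measurableC.
split; first exact: (measurable_law_family mD measurable_powers_integral mA).
apply: (eq_measurable_fun (cst ((dirac (0 : RT) : law R) A))) => //.
move=> t /set_mem /=; rewrite in_itv/= andbT => /negP; rewrite -leNgt => t0.
by rewrite nt0.
Qed.

Lemma exp_weight_ge0 (theta t : R) : 0 <= theta -> 0 <= exp_weight theta t.
Proof. by move=> theta0; rewrite mulr_ge0// expR_ge0. Qed.

(** The law of nu^t for t exponential of rate theta. *)
Definition powers_mixture (theta : R) (theta0 : 0 < theta) : law R :=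
  @mixture_law _ RT R leb D mD (exp_weight theta) nt
    (fun t => exp_weight_ge0 t (ltW theta0)) (measurable_exp_weight theta)
    measurable_powers (exp_weight_total theta0).

Lemma integral_powers_mixture theta (theta0 : 0 < theta) (f : RT -> \bar R) :
  measurable_fun setT f -> (forall x, 0 <= f x)%E ->
  (\int[powers_mixture theta0]_x f x =
   \int[leb]_(t in D) ((exp_weight theta t)%:E * \int[nt t]_x f x))%E.
Proof. exact: integral_mixture. Qed.

Lemma supported_powers_mixture theta (theta0 : 0 < theta) :
  supported_on `[0, +oo[ (powers_mixture theta0).
Proof.
apply: setC_supported => //.
change (mixture leb D (exp_weight theta) nt (~` `[0, +oo[%classic) = 0%E).
rewrite /mixture integral0_eq// => t /=; rewrite in_itv/= andbT => t0.
by rewrite supported_setC ?mule0//; case: (ntP t0) => -[].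
Qed.

(** The transform of nu^t is exp(-c t) with c = - log of that of nu, and the product
    of exp(-c t) with the density of rate theta is theta / (theta + c) times the
    density of rate theta + c. *)
Lemma elaplace_powers_mixture theta (theta0 : 0 < theta) l : 0 <= l ->
  elaplace (powers_mixture theta0) l = (theta / (theta - ln (laplace nu l)))%:E.
Proof.
move=> l0.
have L0 := laplace_gt0 snu l0; have L1 := laplace_le1 snu l0.
pose c := - ln (laplace nu l).
have c0 : 0 <= c by rewrite oppr_ge0 ln_le0.
have tc0 : 0 < theta + c by rewrite ltr_wpDr.
rewrite /elaplace integral_powers_mixture; last 2 first.
- exact: measurable_expRN.
- by move=> x; rewrite lee_fin expR_ge0.
transitivity (\int[leb]_(t in D) ((theta / (theta + c))%:E * (exp_weight (theta + c) t)%:E))%E.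
  apply: eq_integral => t /set_mem /=; rewrite in_itv/= andbT => t0.
  have [[snt Lnt] _] := ntP t0.
  have := elaplaceE snt l0; rewrite /elaplace => ->.
  rewrite Lnt// /powR gt_eqF// -!EFinM; congr (_%:E).
  rewrite /exp_weight mulrA divfK ?gt_eqF// -mulrA -expRD; congr (_ * expR _).
  by rewrite /c; ring.
rewrite ge0_integralZl_EFin//.
- by rewrite exp_weight_total// mule1.
- by move=> t _; rewrite lee_fin exp_weight_ge0// ltW.
- apply: measurable_funTS; apply/measurable_EFinP; exact: measurable_exp_weight.
- by rewrite divr_ge0// ltW.
Qed.

Let one_gt0 : 0 < 1 :> R := ltr01.

(** The term of the empty sum is kept apart because [steps b t] is positive for t > 0. *)
Lemma integral_geometric_law (b : R) (b01 : 0 < b < 1) (q : nat -> law R) (g : RT -> \bar R) :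
  measurable_fun setT g -> (forall x, 0 <= g x)%E ->
  (\int[geometric_law b01 q]_x g x = (1 - b)%:E * g (0 : R)%R +
   \int[leb]_(t in D) ((b ^+ steps b t)%:E * \int[convolution_upto q (steps b t)]_x g x))%E.
Proof.
move=> mg g0; have /andP[b0 b1] := b01.
have c0 k : 0 <= (1 - b) * b ^+ k by rewrite mulr_ge0 ?subr_ge0 ?exprn_ge0// ltW.
have pos k : (0 <= ((1 - b) * b ^+ k)%:E * \int[convolution_upto q k]_x g x)%E.
  by rewrite mule_ge0 ?lee_fin//; exact: integral_ge0.
rewrite (integral_countable_mixture c0 (geometric_law_mixture b01 q))//.
rewrite nneseries_recl// -nneseries_addn//; congr (_ + _)%E.
  by rewrite expr0 mulr1 /= integral_dirac// diracT mul1e.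
rewrite (integral_steps (u := fun k => (b ^+ k)%:E * \int[convolution_upto q k]_x g x)%E)//.
  by apply: eq_eseriesr => k _; rewrite addn1 muleA EFinM.
move=> k; apply: mule_ge0; last exact: integral_ge0.
by rewrite lee_fin exprn_ge0// ltW.
Qed.

Let geometric_law_cvg_ge0 (g : R -> R) (M : R) : continuous g ->
  (forall x, 0 <= g x <= M) ->
  (\int[geometric_law (a01 n) (pi_ n)]_x (g x)%:E @[n --> \oo] -->
   \int[powers_mixture one_gt0]_x (g x)%:E)%E.
Proof.
move=> gc gM.
have g0 x : 0 <= g x by case/andP: (gM x).
have gn x : `|g x| <= M by case/andP: (gM x) => *; rewrite ger0_norm.
have M0 : 0 <= M by exact: le_trans (g0 0) (proj2 (andP (gM 0))).
have mg : measurable_fun [set: RT] (fun x : RT => (g x)%:E).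
  by apply/measurable_EFinP; exact: measurable_continuous.
have fin (mu : law R) : (\int[mu]_x (g x)%:E = (\int[mu]_x g x)%:E)%E.
  rewrite fineK//; apply: integrable_fin_num => //; apply: (@integrable_bounded _ _ _ M) => //.
  exact: measurable_continuous.
have pg0 (mu : law R) : 0 <= \int[mu]_x g x by exact: Rintegral_ge0.
have pgM (mu : law R) : \int[mu]_x g x <= M.
  rewrite -[leRHS](prob_mean_cst mu); apply: le_Rintegral => //.
  - apply: (@integrable_bounded _ _ _ M) => //; exact: measurable_continuous.
  - by apply: (@integrable_bounded _ _ (cst M) M) => // x; rewrite ger0_norm.
  - by move=> x _; case/andP: (gM x).
pose u n t := a n ^+ steps (a n) t * \int[convolution_upto (pi_ n) (steps (a n) t)]_x g x.
pose v t := exp_weight 1 t * \int[nt t]_x g x.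
have -> : (\int[powers_mixture one_gt0]_x (g x)%:E = (0 + \int[leb]_(t in D) (v t)%:E))%E.
  rewrite add0e integral_powers_mixture//.
  by apply: eq_integral => t _; rewrite fin -EFinM.
have uE n : (\int[geometric_law (a01 n) (pi_ n)]_x (g x)%:E =
    ((1 - a n) * g 0)%:E + \int[leb]_(t in D) (u n t)%:E)%E.
  rewrite integral_geometric_law//.
  by rewrite EFinM; congr (_ + _)%E; apply: eq_integral => t _; rewrite fin -EFinM.
rewrite (funext uE).
have cp : (1 - a n) * g 0 @[n --> \oo] --> (0 : R).
  rewrite -[X in _ --> X](mul0r (g 0)); apply: cvgMl; rewrite -[X in _ --> X](subrr 1).
  by apply: cvgB => //; exact: cvg_cst.
have cint : (\int[leb]_(t in D) (u n t)%:E @[n --> \oo] --> \int[leb]_(t in D) (v t)%:E)%E.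
  apply: (@dominated_cvg _ _ _ leb D mD (fun n t => (u n t)%:E) _
    (fun t => M%:E * (exp_weight 1 t)%:E)%E).
  - move=> n; apply/measurable_EFinP.
    apply: (measurable_steps (fun k => a n ^+ k * \int[convolution_upto (pi_ n) k]_x g x)).
    by case/andP: (a01 n).
  - move=> t /=; rewrite in_itv/= andbT => t0; apply: cvg_EFin; first exact: nearW.
    rewrite /v /exp_weight !mul1r; apply: cvgM; first exact: cvg_expr_steps.
    by apply: (ntP t0).2 => //; exists M.
  - by [].
  - apply: integrableZl => //; apply/integrableP; split.
      by apply: measurable_funTS; apply/measurable_EFinP; exact: measurable_exp_weight.
    under eq_integral do rewrite gee0_abs ?lee_fin ?exp_weight_ge0//.
    by rewrite exp_weight_total// ltry.
  - move=> n t /=; rewrite in_itv/= andbT => t0; have /andP[an0 _] := a01 n.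
    rewrite lee_fin ger0_norm; last by rewrite mulr_ge0// exprn_ge0// ltW.
    rewrite mulrC ler_pM ?exprn_ge0 ?(ltW an0)// /exp_weight !mul1r.
    exact: expr_steps_le.
apply: cvgeD => //; first exact: cvg_EFin (nearW _ _) cp.
Qed.

(** A bounded test function becomes nonnegative after adding a constant. *)
Theorem geometric_law_cvg :
  weak_cvg (fun n => geometric_law (a01 n) (pi_ n)) (powers_mixture one_gt0).
Proof.
move=> f fc [M fM].
pose g x := f x + M.
have gM x : 0 <= g x <= 2 * M.
  by have := fM x; rewrite ler_norml /g => /andP[? ?]; apply/andP; split; lra.
have gc : continuous g by move=> x; apply: cvgD; [exact: fc|exact: cvg_cst].
have M0 : 0 <= M by rewrite (le_trans (normr_ge0 _) (fM 0)).
have E (mu : law R) : \int[mu]_x f x = fine (\int[mu]_x (g x)%:E)%E - M.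
  rewrite -[X in _ - X](prob_mean_cst mu).
  have jM : mu.-integrable [set: RT] (EFin \o cst M).
    by apply: (@integrable_bounded _ _ (cst M) M) => // x; rewrite ger0_norm.
  have jg : mu.-integrable [set: RT] (EFin \o g).
    apply: (@integrable_bounded _ _ g (2 * M)); first exact: measurable_continuous.
    by move=> x; case/andP: (gM x) => ? ?; rewrite ger0_norm.
  rewrite -(RintegralB measurableT jg jM).
  by apply: eq_Rintegral => x _; rewrite /g addrK.
rewrite E (funext (fun n => E (geometric_law (a01 n) (pi_ n)))).
apply: cvgB; last exact: cvg_cst.
apply: fine_cvg; rewrite fineK; first exact: geometric_law_cvg_ge0.
apply: integrable_fin_num => //; apply: (@integrable_bounded _ _ g (2 * M)).
  exact: measurable_continuous.
by move=> x; case/andP: (gM x) => ? ?; rewrite ger0_norm.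
Qed.

(** The summands for the parameter p are distributed as the mixture of rate 1 / p;
    the transforms are compared in the last lines. *)
Theorem powers_mixture_gid : geometrically_infinitely_divisible (powers_mixture one_gt0).
Proof.
move=> p p01; have /andP[p0 p1] := p01.
have theta0 : 0 < p^-1 by rewrite invr_gt0.
have [d [Om [P [X [G [iX dX gG iG XE] ] ] ] ] ] :=
  iid_geometric_exists (powers_mixture theta0) p01.
exists d, Om, P, X, G; split => //.
have mG k : measurable (G @^-1` [set k]).
  by rewrite -[Z in measurable Z]setTI; exact: (measurable_funPT G).
have mS : measurable_fun setT (fun w => \sum_(i < G w) (X i w : R) : RT).
  move=> _ A mA; rewrite setTI.
  rewrite (_ : _ @^-1` A = \bigcup_k (G @^-1` [set k] `&` partial_sum X k @^-1` A)).
    apply: bigcupT_measurable => k; apply: measurableI => //.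
    by rewrite -[Z in measurable Z]setTI; exact: measurable_partial_sum.
  apply/seteqP; split => w /=; first by move=> Aw; exists (G w).
  by move=> [k _ [/= ->]].
pose S : {RV P >-> RT} := @mfun_Sub _ _ Om RT _ (mem_set mS).
pose mu := distribution P (X 0%N) : law R.
have muE (A : set RT) : measurable A -> mu A = powers_mixture theta0 A.
  by move=> mA; exact: XE.
have smu : supported_on `[0, +oo[ mu.
  by rewrite /supported_on muE//; exact: supported_powers_mixture.
have SE (A : set RT) : measurable A -> (distribution P S A =
   \sum_(k <oo) ((1 - (1 - p)) * (1 - p) ^+ k)%:E * convolution_upto (fun=> mu) (k + 1) A)%E.
  by move=> mA; exact: (random_sum_law iX dX p01 gG iG mA).
have sS : supported_on `[0, +oo[ (distribution P S : law R).
  have mN : measurable (~` `[0, +oo[%classic : set RT) by exact: measurableC.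
  apply: setC_supported => //; apply: (etrans (SE _ mN)); rewrite eseries0// => k _ _.
  by rewrite supported_setC ?mule0//; exact: supported_convolution_upto.
apply: (@laplace_unique R _ (distribution P S : law R)) => //.
  exact: supported_powers_mixture.
move=> k; set l := k%:R; have l0 : 0 <= l by rewrite /l.
have q01 : 0 < 1 - p < 1 by rewrite subr_gt0 p1 gtrBl.
apply: EFin_inj; rewrite -!elaplaceE//; last exact: supported_powers_mixture.
rewrite elaplace_powers_mixture//.
rewrite (laplace_geometric_mixture q01 l0 smu SE); congr (_%:E).
have -> : laplace mu l = p^-1 / (p^-1 - ln (laplace nu l)).
  apply: EFin_inj; rewrite -elaplace_powers_mixture//.
  by rewrite elaplaceE ?(eq_laplace _ muE)//; exact: supported_powers_mixture.
have c0 : ln (laplace nu l) <= 0 by rewrite ln_le0// laplace_le1.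
set c := ln _ in c0 *.
rewrite subKr expr1.
have -> : p^-1 / (p^-1 - c) = (1 - p * c)^-1.
  by field; rewrite !gt_eqF//; nra.
have pc : 0 < 1 - p * c by nra.
have c1 : 0 < 1 - c by lra.
by field; rewrite !gt_eqF//; nra.
Qed.

End limit_is_gid.

Theorem geometric_limit_is_gid (R : realType) (a : nat -> R) (a01 : forall n, 0 < a n < 1)
    (pi_ : nat -> nat -> law R) (nu : law R) :
  a n @[n --> \oo] --> (1 : R) -> supported_on `[0, +oo[%classic nu ->
  (forall tau : R, 0 < tau -> exists2 nu_tau : law R,
     is_convolution_power nu tau nu_tau &
     weak_cvg (fun n => convolution_upto (pi_ n) (steps (a n) tau)) nu_tau) ->
  exists2 rho : law R,
    weak_cvg (fun n => geometric_law (a01 n) (pi_ n)) rho &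
    geometrically_infinitely_divisible rho.
Proof.
move=> a1 snu H.
have /choice[nt ntP] t : exists m : law R,
    (0 < t -> is_convolution_power nu t m /\
      weak_cvg (fun n => convolution_upto (pi_ n) (steps (a n) t)) m) /\
    (t <= 0 -> m = (dirac (0 : measurableTypeR R) : law R)).
  have [t0|t0] := ltP 0 t.
    by have [m ? ?] := H t t0; exists m.
  by exists (dirac (0 : measurableTypeR R) : law R); split.
exists (powers_mixture a01 (fun t => (ntP t).1) (fun t => (ntP t).2) ltr01).
  exact: geometric_law_cvg.
exact: powers_mixture_gid.
Qed.

Theorem proposition3p3 (R : realType) :
  (forall (a : nat -> R) (a01 : forall n, 0 < a n < 1)
      (pi_ : nat -> nat -> law R) (nu : law R),
    (forall n m : nat, (0 < m)%N -> supported_on `]0, +oo[%classic (pi_ n m)) ->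
    nondecreasing_seq a -> a n @[n --> \oo] --> (1 : R) ->
    supported_on `[0, +oo[%classic nu -> infinitely_divisible nu ->
    nu [set 0] = 0%E ->
    (forall tau : R, 0 < tau -> exists2 nu_tau : law R,
       is_convolution_power nu tau nu_tau &
       weak_cvg (fun n => convolution_upto (pi_ n) (steps (a n) tau)) nu_tau) ->
    exists2 rho : law R,
      weak_cvg (fun n => geometric_law (a01 n) (pi_ n)) rho &
      geometrically_infinitely_divisible rho)
  /\
  (forall (a : nat -> R) (a01 : forall n, 0 < a n < 1) (rho : law R),
    nondecreasing_seq a -> a n @[n --> \oo] --> (1 : R) ->
    supported_on `[0, +oo[%classic rho -> geometrically_infinitely_divisible rho ->
    exists pi_ : nat -> nat -> law R,
      [/\ row_constant pi_,
          forall n m : nat, (0 < m)%N -> supported_on `]0, +oo[%classic (pi_ n m),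
          locally_infinitesimal a pi_
        & weak_cvg (fun n => geometric_law (a01 n) (pi_ n)) rho]).
Proof.
split.
- move=> a a01 pi_ nu _ _ a1 snu _ _ cvg_pow.
  exact: geometric_limit_is_gid a1 snu cvg_pow.
- by move=> a a01 rho _ a1 srho gid; exact: gid_is_geometric_limit.
Qed.
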